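(* Let $\mathbb{D}$ be a division ring whose centre satisfies $|Z(\mathbb{D})|>2$, let $n\ge 1$, let $\preceq$ be a preorder on $[n]=\{1,\ldots,n\}$, and let $\mathcal{R}_{\preceq}\subseteq M_n(\mathbb{D})$ be the associated structural matrix ring. Then every injective Jordan semi-triple map $\phi:\mathcal{R}_{\preceq}\to M_n(\mathbb{D})$ is additive if and only if the following two conditions hold: (P) every nonsymmetric comparable pair $(i,j)$ (that is, $i\preceq j$ and $j\not\preceq i$) is nonisolated; (S) if the comparability graph $\Gamma_{\preceq}$ has a singleton connected component, then $\mathbb{D}\cong\mathbb{F}_3$ or $\mathbb{D}\cong\mathbb{F}_4$.
   Context: For a preorder (reflexive and transitive relation) $\preceq$ on $[n]=\{1,\ldots,n\}$, the associated structural matrix ring (SMR) is $\mathcal{R}_{\preceq}:=\{[x_{ij}]\in M_n(\mathbb{D}) : x_{ij}=0 \text{ whenever } i\not\preceq j\}$. A map $\phi:\mathcal{R}\to\mathcal{S}$ between rings (no additivity assumed) is a Jordan semi-triple map if $\phi(xyx)=\phi(x)\phi(y)\phi(x)$ for all $x,y\in\mathcal{R}$. The comparability graph $\Gamma_{\preceq}$ has vertex set $[n]$, and two distinct vertices $i,j$ are joined by an edge precisely when $i\preceq j$ or $j\preceq i$. A pair $(i,j)$ is a nonsymmetric comparable pair if $i\preceq j$ and $j\not\preceq i$. Such a pair is nonisolated if there exists $k\in[n]\setminus\{i,j\}$ such that at least one of $k\preceq i\preceq j$, $i\preceq k\preceq j$, $i\preceq j\preceq k$ holds. $\mathbb{F}_q$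 denotes the field with $q$ elements. *)

(* Defs.v *)
From HB Require Import structures.
From mathcomp Require Import all_boot all_order all_algebra.

Set Implicit Arguments.
Unset Strict Implicit.
Unset Printing Implicit Defensive.

Import GRing.Theory.
Local Open Scope ring_scope.

Definition central (D : pzRingType) (z : D) : Prop :=
  forall x : D, GRing.comm z x.

(* |Z(D)| > k, for a possibly infinite centre *)
Definition center_card_gt (D : nzRingType) (k : nat) : Prop :=
  exists s : seq D,
    [/\ uniq s, (k < size s)%N & forall z, z \in s -> central z].

(* Finite fields are determined up to isomorphism by their cardinality, so any
   finFieldType with q elements serves as F_q. *)
Definition isomorphic_to_Fq (D : nzRingType) (q : nat) : Prop :=
  exists F : finFieldType,
    #|F| = q /\ exists f : {rmorphism D -> F}, bijective f.

Section StructuralMatrixRing.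

Variables (D : nzRingType) (n : nat) (r : rel 'I_n).
Hypotheses (r_refl : reflexive r) (r_trans : transitive r).

Definition smr_pred : {pred 'M[D]_n} :=
  fun x => [forall i, forall j, ~~ r i j ==> (x i j == 0)].

Lemma smr_predP (x : 'M[D]_n) :
  reflect (forall i j, ~~ r i j -> x i j = 0) (x \in smr_pred).
Proof.
apply: (iffP forallP) => [h i j nr | h i].
  by move/forallP: (h i) => /(_ j) /implyP /(_ nr) /eqP.
by apply/forallP => j; apply/implyP => nr; apply/eqP/h.
Qed.

Fact smr_subring_closed : subring_closed smr_pred.
Proof.
split=> [|x y /smr_predP hx /smr_predP hy|x y /smr_predP hx /smr_predP hy];
  apply/smr_predP => i j nr.
- by rewrite mxE; case: eqP nr => // ->; rewrite r_refl.
- by rewrite !mxE hx // hy // subr0.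
rewrite mxE big1 // => k _.
have [rik | /hx ->] := boolP (r i k); last by rewrite mul0r.
rewrite hy ?mulr0 //; apply: contra nr; exact: r_trans.
Qed.

(* The type carries the preorder proofs (which its values do not depend on) so
   that its ring structure can be inferred. *)
Record smr (h : reflexive r) (h' : transitive r) : Type :=
  Smr { smr_val :> 'M[D]_n; smr_valP : smr_val \in smr_pred }.

Local Notation S := (smr r_refl r_trans).

HB.instance Definition _ := [isSub of S for @smr_val r_refl r_trans].
HB.instance Definition _ := [Choice of S by <:].
HB.instance Definition _ :=
  GRing.SubChoice_isSubPzRing.Build 'M[D]_n smr_pred S smr_subring_closed.

End StructuralMatrixRing.

Definition jordan_semi_triple (R S : pzRingType) (phi : R -> S) : Prop :=
  forall x y : R, phi (x * y * x) = phi x * phi y * phi x.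

Definition additive_map (R S : pzRingType) (phi : R -> S) : Prop :=
  {morph phi : x y / x + y}.

Section Preorder.

Variables (n : nat) (r : rel 'I_n).

Definition comparability_graph : rel 'I_n :=
  fun i j => (i != j) && (r i j || r j i).

Definition component (i : 'I_n) : {set 'I_n} :=
  [set j | connect comparability_graph i j].

Definition has_singleton_component : Prop := exists i, #|component i| = 1%N.

Definition nonsymmetric_pair (i j : 'I_n) : Prop := r i j /\ ~~ r j i.

Definition nonisolated (i j : 'I_n) : Prop :=
  exists k : 'I_n, [/\ k != i, k != j &
    [\/ r k i /\ r i j, r i k /\ r k j | r i j /\ r j k]].

End Preorder.

(* Main.v *)
Require Import Defs.
From HB Require Import structures.
From mathcomp Require Import all_boot all_order all_algebra.
From mathcomp Require Import all_fingroup finfield.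

(* After multiplying phi by phi(1) we may assume that phi preserves squares. A
   maximal chain of coordinate idempotents of the structural matrix ring is sent
   to a strictly increasing chain of n + 1 idempotents of M_n(D), whose successive
   differences are n nonzero orthogonal idempotents. Since there is no room for
   more, phi(0) = 0, phi(1) = 1 and each phi(E_ii) is primitive; since D has a
   unit other than 1, the phi(E_ii) are then pairwise orthogonal, and after a
   conjugation phi(E_ii) = E_ii. Now the (i,j) entry of phi(x) depends only on the
   2 x 2 block of x at {i,j}. For i <= j, phi sends D E_ij into D E_ij or into
   D E_ji, and the corresponding entry of phi([[a,b],[0,c]]) is an additive
   function u(b) unless a = c = 0, where it is another additive function. The two
   functions agree if j <= i, or as soon as a third index witnesses that (i,j) is
   nonisolated.

   Conversely, if (i,j) is isolated, multiplying x_ij by a central element other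
   than 0 and 1 when x_ii = x_jj = 0 is not additive; and if i is a singleton
   component, replacing x_ii by its inverse is additive only over F_3 and F_4. *)

Set Implicit Arguments.
Unset Strict Implicit.
Unset Printing Implicit Defensive.

Import GRing.Theory.
Local Open Scope ring_scope.

Lemma division_mul_eq0 (D : unitRingType) (D_div : GRing.field_axiom D) (a b : D) :
  a * b = 0 -> a = 0 \/ b = 0.
Proof.
move=> ab0; have [->|a0] := eqVneq a 0; [by left | right].
by apply: (mulrI (D_div _ a0)); rewrite ab0 mulr0.
Qed.

(** * Products with matrix units over an arbitrary ring *)

Section MatrixUnits.

Variables (D : nzRingType) (n : nat).
Implicit Types (A B X Y : 'M[D]_n) (i j k l p q : 'I_n).

Lemma delta_mx_corner k A :
  delta_mx k k * A * delta_mx k k = A k k *: delta_mx k k.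
Proof.
apply/matrixP => i j; rewrite !mxE (bigD1 k) //= big1 => [|l ne_lk]; last first.
  by rewrite [delta_mx _ _ _ _]mxE (negbTE ne_lk) mulr0.
rewrite !mxE (bigD1 k) //= big1 => [|l ne_lk]; last first.
  by rewrite !mxE (negbTE ne_lk) andbF mul0r.
rewrite !mxE !eqxx /= !addr0 andbT.
by case: (i == k); case: (j == k); rewrite ?(mul0r, mul1r, mulr0, mulr1).
Qed.

Lemma mul_delta (i j k l : 'I_n) (a b : D) :
  (a *: delta_mx i j) * (b *: delta_mx k l) =
  if j == k then (a * b) *: delta_mx i l else 0 :> 'M[D]_n.
Proof.
apply/matrixP => u v; rewrite !mxE (bigD1 j) //= big1 => [|m ne_mj]; last first.
  by rewrite !mxE (negbTE ne_mj) andbF mulr0 mul0r.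
rewrite !mxE eqxx andbT addr0; case: (j == k) => /=; last by rewrite mulr0 mxE mulr0.
by rewrite !mxE; case: (u == i); case: (v == l); rewrite /= ?(mulr0, mul0r, mulr1).
Qed.

Lemma mul_delta_mul k l (a : D) A B i j :
  (A * (a *: delta_mx k l) * B) i j = A i k * a * B l j.
Proof.
rewrite mxE (bigD1 l) //= big1 => [|m ne_ml]; last first.
  rewrite mxE big1 ?mul0r // => p _.
  by rewrite !mxE (negbTE ne_ml) andbF !mulr0.
rewrite addr0 mxE (bigD1 k) //= big1 => [|m ne_mk]; last first.
  by rewrite !mxE (negbTE ne_mk) !mulr0.
by rewrite !mxE !eqxx mulr1 addr0.
Qed.

Lemma mulmx_delta_row A i j a : (forall k, k != i -> A k i = 0) ->
  A * (a *: delta_mx i j) = (A i i * a) *: delta_mx i j.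
Proof.
move=> Ai; apply/matrixP => k l; rewrite mxE (bigD1 i) //= big1 => [|m ne_mi]; last first.
  by rewrite !mxE (negbTE ne_mi) !mulr0.
rewrite !mxE eqxx addr0 /= mulrA; case: (eqVneq k i) => [->//|/Ai->] /=.
by rewrite !mul0r mulr0.
Qed.

Lemma delta_mulmx_col A i j a : (forall k, k != j -> A j k = 0) ->
  (a *: delta_mx i j) * A = (a * A j j) *: delta_mx i j.
Proof.
move=> Aj; apply/matrixP => k l; rewrite mxE (bigD1 j) //= big1 => [|m ne_mj]; last first.
  by rewrite !mxE (negbTE ne_mj) andbF mulr0 mul0r.
rewrite !mxE eqxx andbT addr0; case: (k == i) => /=; last by rewrite !mulr0 mul0r.
rewrite mulr1; case: (eqVneq l j) => [->|/Aj->] /=; by rewrite ?mulr1 ?mulr0.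
Qed.

Lemma triple_entry X Y (a b : 'I_n) p q :
  (forall c, c != p -> X a c = 0) -> (forall c, c != q -> X c b = 0) ->
  (X * Y * X) a b = X a p * Y p q * X q b.
Proof.
move=> Xa Xb; rewrite mxE (bigD1 q) //= big1 => [|c /Xb->]; last by rewrite mulr0.
rewrite mxE (bigD1 p) //= big1 => [|c /Xa->]; last by rewrite mul0r.
by rewrite !addr0.
Qed.

End MatrixUnits.

(** * Linear algebra over a division ring: orthogonal idempotents *)

Section DivisionRingMatrices.

Variables (D : unitRingType) (D_div : GRing.field_axiom D).

(* Gaussian elimination by hand: mxalgebra needs a commutative field. *)
Lemma left_kernel_neq0 n m (A : 'M[D]_(m, n)) :
  (n < m)%N -> exists2 c : 'rV_m, c != 0 & c *m A = 0.
Proof.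
elim: n m A => [|n IHn] [|m] A // lt_nm.
  exists (const_mx 1); last by rewrite [LHS]thinmx0.
  by apply/eqP => /rowP/(_ 0)/eqP; rewrite !mxE oner_eq0.
have [i Ai0 | A0] := pickP (fun i => A i 0 != 0); last first.
  have [|c c0 cA] := IHn _ (col' 0 A); first exact: ltnW.
  exists c => //; apply/rowP => j; have [k ->|->] := unliftP 0 j.
    have /rowP/(_ k) := cA; rewrite !mxE => cAk; rewrite -[RHS]cAk.
    by apply: eq_bigr => l _; rewrite !mxE.
  rewrite !mxE big1 // => l _; move/negbFE/eqP: (A0 l) => ->; exact: mulr0.
pose w k := A (lift i k) 0 * (A i 0)^-1.
have [|c c0 cB] :=
  IHn m (\matrix_(k, j) (A (lift i k) (lift 0 j) - w k * A i (lift 0 j))).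
  by [].
(* The coefficient of the pivot row i is chosen to cancel column 0; in the other columns [c']
   reproduces the relation for the reduced matrix. *)
pose c' k := if unlift i k is Some l then c 0 l else - \sum_l c 0 l * w l.
exists (\row_k c' k).
  apply: contra_neq c0 => /rowP e; apply/rowP => l.
  by have := e (lift i l); rewrite !mxE /c' liftK.
apply/rowP => j; rewrite !mxE (bigD1_ord i) //= mxE /c' unlift_none.
under eq_bigr do rewrite mxE liftK.
rewrite mulNr mulr_suml addrC -sumrB.
have [k ->|->] := unliftP 0 j; last first.
  apply: big1 => l _; rewrite /w -!mulrA mulVr ?mulr1 ?subrr //; exact: D_div.
have /rowP/(_ k) := cB; rewrite !mxE => cBk; rewrite -[RHS]cBk; apply: eq_bigr => l _.
by rewrite !mxE mulrBr -!mulrA.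
Qed.

(** A dimension count: the n + 1 rows of b and A are left dependent, and regularity makes the
    coefficient of b nonzero, so every b lies in the left row span. This gives B A = 1; then (A B -
    1) A = 0, and regularity gives A B = 1. *)
Lemma left_regular_inv n (A : 'M[D]_n) :
  (forall c : 'rV_n, c *m A = 0 -> c = 0) -> exists B, B *m A = 1%:M /\ A *m B = 1%:M.
Proof.
move=> A_reg.
have regM m (C : 'M_(m, n)) : C *m A = 0 -> C = 0.
  by move=> CA; apply/row_matrixP => i; rewrite row0; apply: A_reg; rewrite -row_mul CA row0.
have row_span (b : 'rV_n) : exists c : 'rV_n, c *m A == b.
  have [|c c0 cAb] := left_kernel_neq0 (col_mx b A); first by [].
  pose d := c 0 (lshift n 0).
  have: lsubmx c *m b + rsubmx c *m A = 0 by rewrite -mul_row_col hsubmxK.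
  rewrite (_ : lsubmx c = d%:M); last first.
    by apply/matrixP => i j; rewrite !ord1 !mxE mulr1n.
  rewrite mul_scalar_mx => dbA.
  have d0: d != 0.
    apply: contra_neq c0 => d0; move: dbA; rewrite d0 scale0r add0r => /A_reg rc0.
    rewrite -[c]hsubmxK rc0 (_ : lsubmx c = 0) ?row_mx0 //.
    by apply/matrixP => i j; rewrite !ord1 !mxE.
  exists (- d^-1 *: rsubmx c); rewrite -scalemxAl scaleNr -scalerN.
  move/eqP: dbA; rewrite addrC addr_eq0 => /eqP ->.
  by rewrite opprK scalerA mulVr ?scale1r //; apply: D_div.
pose B := \matrix_i xchoose (row_span (row i 1%:M)).
have BA: B *m A = 1%:M.
  by apply/row_matrixP => i; rewrite row_mul rowK; apply/eqP/(xchooseP (row_span _)).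
exists B; split => //; apply/eqP; rewrite -subr_eq0; apply/eqP/regM.
by rewrite mulmxBl -mulmxA BA mulmx1 mul1mx subrr.
Qed.

Section OrthogonalIdempotents.

Variables (n : nat) (d : 'I_n -> 'M[D]_n).
Hypotheses (d_neq0 : forall k, d k != 0).
Hypotheses (d_orth : forall k l, d k * d l = if k == l then d k else 0).

(** Choose a nonzero row v_k of each d_k. Then v_k d_l is v_k if k = l and 0 otherwise, so the v_k
    are left independent, and the matrix g with these rows is invertible and turns d_k into E_kk. *)
Lemma orthogonal_idempotents_conj :
  exists g h : 'M[D]_n,
    [/\ g * h = 1, h * g = 1 & forall k, g * d k = delta_mx k k * g].
Proof.
have row_neq0 k : exists i, row i (d k) != 0.
  apply/existsP; apply: contraNT (d_neq0 k); rewrite negb_exists => /forallP dk0.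
  apply/eqP/row_matrixP => i; rewrite row0; apply/eqP; move: (dk0 i); exact: negbNE.
pose v k := row (xchoose (row_neq0 k)) (d k).
have v_neq0 k : v k != 0 by apply: (xchooseP (row_neq0 k)).
pose g := \matrix_k v k.
have gd k : g * d k = delta_mx k k * g.
  have vd i : v i *m d k = if i == k then v i else 0.
    rewrite /v -row_mul (_ : _ *m _ = d i * d k) // d_orth.
    by case: eqP => // _; rewrite row0.
  apply/row_matrixP => i; rewrite -mulmxE !row_mul rowK vd.
  have [-> | ne_ik] := eqVneq i k.
    rewrite -[in LHS](rowK v k) -/g [row k g]rowE; congr (_ *m _).
    by apply/rowP => j; rewrite !mxE !eqxx.
  rewrite (_ : row i (delta_mx k k) = 0) ?mul0mx //.
  by apply/rowP => j; rewrite !mxE (negbTE ne_ik).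
have [|h [hg gh]] := @left_regular_inv n g; last by exists g, h.
move=> c cg; apply/rowP => k; rewrite mxE; apply: contraNeq (v_neq0 k) => ck.
apply/eqP/rowP => j; rewrite mxE.
have /rowP/(_ j) : c *m (g *m d k) = 0 by rewrite mulmxA cg mul0mx.
rewrite mulmxE gd -mulmxE !mxE (bigD1 k) //= big1 => [|l ne_lk]; last first.
  by rewrite mxE big1 ?mulr0 // => m _; rewrite mxE (negbTE ne_lk) mul0r.
rewrite addr0 mxE (bigD1 k) //= big1 => [|l ne_lk]; last first.
  by rewrite mxE (negbTE ne_lk) andbF mul0r.
rewrite !mxE !eqxx mul1r addr0 => /(congr1 (fun z => (c 0 k)^-1 * z)).
by rewrite mulr0 mulrA mulVr ?mul1r //; apply: D_div.
Qed.

(** After conjugation the d_k are the diagonal matrix units, and a matrix killed by all of them has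
    only zero columns. *)
Lemma orthogonal_idempotents_max (A : 'M[D]_n) : (forall k, A * d k = 0) -> A = 0.
Proof.
move=> Ad0; have [g [h [gh hg gd]]] := orthogonal_idempotents_conj.
suff Ah0: A * h = 0 by rewrite -[A]mulr1 -hg mulrA Ah0 mul0r.
have AhE k : A * h * delta_mx k k = 0.
  have -> : A * h * delta_mx k k = A * (h * g) * d k * h.
    by rewrite -!mulrA (mulrA g) gd -!mulrA gh mulr1.
  by rewrite hg mulr1 Ad0 mul0r.
apply/matrixP => i k; have /matrixP/(_ i k) := AhE k.
rewrite -[X in _ = X -> _]/((0 : 'M[D]_n) i k) => <-; rewrite [RHS]mxE (bigD1 k) //=.
rewrite big1 => [|l ne_lk]; first by rewrite !mxE !eqxx mulr1 addr0.
by rewrite [delta_mx _ _ _ _]mxE (negbTE ne_lk) mulr0.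
Qed.

(** Each d_k is primitive: after conjugation its corner is D E_kk, a copy of the division ring D. *)
Lemma orthogonal_idempotent_corner_inv k (A : 'M[D]_n) :
  d k * A * d k != 0 -> exists B, d k * A * d k * B = d k.
Proof.
have [g [h [gh hg gd]]] := orthogonal_idempotents_conj.
have dE: d k = h * delta_mx k k * g by rewrite -mulrA -gd mulrA hg mul1r.
pose a := (g * A * h) k k.
have dAd: d k * A * d k = h * (a *: delta_mx k k) * g.
  by rewrite /a -delta_mx_corner dE !mulrA.
rewrite dAd => nz; have a0: a != 0.
  by apply: contraNneq nz => ->; rewrite scale0r mulr0 mul0r.
exists (h * (a^-1 *: delta_mx k k) * g).
rewrite -!mulrA (mulrA g) gh mul1r dE -!mulrA; congr (h * _); rewrite !mulrA.
congr (_ * g); apply/matrixP => i j; rewrite !mxE (bigD1 k) //=.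
rewrite big1 => [|l ne_lk]; last by rewrite !mxE (negbTE ne_lk) andbF mulr0 mul0r.
rewrite !mxE !eqxx addr0 /=; case: (i == k) => /=; last by rewrite mulr0 mul0r.
by rewrite mulr1 mulrA mulrV ?mul1r //; apply: D_div.
Qed.

End OrthogonalIdempotents.

End DivisionRingMatrices.

(** * Members of the structural matrix ring and its coordinate idempotents *)

Section StructuralMatrixRingElements.

Variables (D : nzRingType) (n : nat) (r : rel 'I_n).
Hypotheses (r_refl : reflexive r) (r_trans : transitive r).

Local Notation P := (@smr_pred D n r).

Lemma smr_pred1 : (1 : 'M[D]_n) \in P.
Proof. by have [] := smr_subring_closed D r_refl r_trans. Qed.

Lemma smr_predM : {in P &, forall x y, x * y \in P}.
Proof. by have [] := smr_subring_closed D r_refl r_trans. Qed.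

Lemma smr_predD : {in P &, forall x y, x + y \in P}.
Proof.
by move=> x y /smr_predP xP /smr_predP yP; apply/smr_predP => i j nr; rewrite mxE xP // yP // addr0.
Qed.

Lemma smr_predZ_delta a i j : r i j -> a *: delta_mx i j \in P.
Proof.
move=> rij; apply/smr_predP => k l; rewrite !mxE.
by case: (eqVneq k i) => [->|_]; case: (eqVneq l j) => [->|_]; rewrite ?rij ?mulr0.
Qed.

Lemma smr_pred_delta i j : r i j -> delta_mx i j \in P.
Proof. by move=> rij; rewrite -[delta_mx i j]scale1r smr_predZ_delta. Qed.

Definition coord_idem (S : {set 'I_n}) : 'M[D]_n := diag_mx (\row_i (i \in S)%:R).

Lemma coord_idem_smr S : coord_idem S \in P.
Proof.
apply/smr_predP => i j nr; rewrite !mxE.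
by case: eqP nr => [->|]; rewrite ?r_refl.
Qed.

Lemma coord_idemM S T : coord_idem S * coord_idem T = coord_idem (S :&: T).
Proof.
rewrite /coord_idem -mulmxE mulmx_diag; congr diag_mx; apply/rowP => i.
by rewrite !mxE inE; case: (i \in S); case: (i \in T); rewrite ?(mul0r, mulr0, mul1r).
Qed.

Lemma coord_idem_inj : injective coord_idem.
Proof.
move=> S T /matrixP eqST; apply/setP => i; have := eqST i i.
rewrite !mxE eqxx /=.
by case: (i \in S); case: (i \in T) => // /eqP; rewrite ?oner_eq0 // eq_sym oner_eq0.
Qed.

Lemma coord_idem0 : coord_idem set0 = 0.
Proof. by apply/matrixP => i j; rewrite !mxE inE mul0rn. Qed.

Lemma coord_idem1 i : coord_idem [set i] = delta_mx i i.
Proof.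
apply/matrixP => j k; rewrite !mxE inE.
case: (eqVneq j k) => [->|ne_jk]; first by rewrite andbb; case: (k == i).
case: (eqVneq j i) => [eji|_] //=; case: eqVneq => // eki.
by rewrite eji eki eqxx in ne_jk.
Qed.

End StructuralMatrixRingElements.

(** * The unital case: images of coordinate idempotents *)

Section UnitalJordanSemiTriple.

Variables (D : unitRingType) (D_div : GRing.field_axiom D).
Variables (n : nat) (r : rel 'I_n).
Hypotheses (n_ge1 : (1 <= n)%N) (r_refl : reflexive r) (r_trans : transitive r).
Hypothesis D_gt2 : exists2 a : D, a != 0 & a != 1.

Local Notation P := (@smr_pred D n r).
Local Notation E := (@coord_idem D n).

Variable Phi : 'M[D]_n -> 'M[D]_n.
Hypothesis Phi_inj : {in P &, injective Phi}.
Hypothesis Phi_jst : {in P &, forall x y, Phi (x * y * x) = Phi x * Phi y * Phi x}.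
Hypothesis Phi_unit : {in P, forall x, Phi 1 * Phi x = Phi x /\ Phi x * Phi 1 = Phi x}.

Let E_smr S : E S \in P := coord_idem_smr D r_refl S.
Let one_smr : (1 : 'M[D]_n) \in P := smr_pred1 D r_refl r_trans.

Lemma jst_sqr : {in P, forall x, Phi (x * x) = Phi x * Phi x}.
Proof.
move=> x xP; rewrite -{1}[x]mulr1 Phi_jst //.
by have [_ ->] := Phi_unit xP.
Qed.

(** For S contained in T, E_S = E_T E_S E_T, so [Phi (E S)] begins and ends with the idempotent
    [Phi (E T)], which is therefore absorbed on either side. *)
Lemma jst_coordM (S T : {set 'I_n}) : S \subset T ->
  Phi (E S) * Phi (E T) = Phi (E S) /\ Phi (E T) * Phi (E S) = Phi (E S).
Proof.
move=> /setIidPl ST; have TST: Phi (E T) * Phi (E S) * Phi (E T) = Phi (E S).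
  by rewrite -Phi_jst // !coord_idemM setIC setIA setIid setIC ST.
have TT: Phi (E T) * Phi (E T) = Phi (E T) by rewrite -jst_sqr // coord_idemM setIid.
by split; rewrite -{1}TST; [rewrite -!mulrA TT mulrA | rewrite !mulrA TT].
Qed.

Section Chain.

Variable s : {perm 'I_n}.

(** [S k] holds the first k indices in the order given by [s], so the [E (S k)] form a maximal chain
    from 0 to 1. The order is left free so that any index can come first. *)
Let S k := [set i | (s i < k)%N].
Let q k := Phi (E (S k)).

Definition chain_step (k : 'I_n) := q k.+1 - q k.

Lemma chain_idemM k l : q k * q l = q (minn k l).
Proof.
have sub a b : (a <= b)%N -> S a \subset S b.
  by move=> ab; apply/subsetP => i; rewrite !inE => /leq_trans; apply.
by case: (leqP k l) => [/sub|/ltnW/sub] /jst_coordM[].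
Qed.

Lemma chain_step_orth k l : chain_step k * chain_step l = if k == l then chain_step k else 0.
Proof.
rewrite /chain_step !mulrBl !mulrBr !chain_idemM -(inj_eq val_inj) /=.
case: ltngtP => [kl|lk|->].
- by rewrite !(minn_idPl _) ?subrr // ltnW // ltnW.
- by rewrite !(minn_idPr _) ?subrr // ltnW // ltnW.
- by rewrite !minnn (minn_idPl (leqnSn l)) (minn_idPr (leqnSn l)) subrr subr0.
Qed.

Lemma chain_step_neq0 k : chain_step k != 0.
Proof.
rewrite subr_eq0; apply/eqP => /(Phi_inj (E_smr _) (E_smr _))/coord_idem_inj/setP.
by move/(_ (s^-1 k)%g); rewrite !inE permKV ltnSn ltnn.
Qed.

End Chain.

Let chain_max s A : (forall k, A * chain_step s k = 0) -> A = 0 :=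
  @orthogonal_idempotents_max D D_div n _ (chain_step_neq0 s) (chain_step_orth s) A.

(** [Phi 0] is the bottom of the chain, so [Phi 0 * q k = Phi 0] for every k and [Phi 0] kills every
    step. *)
Lemma jst0 : Phi 0 = 0.
Proof.
have -> : Phi 0 = Phi (E [set i | ((1 : {perm 'I_n})%g i < 0)%N]).
  by congr Phi; rewrite -coord_idem0; congr E; apply/setP => i; rewrite !inE.
by apply: (@chain_max 1%g) => k; rewrite mulrBr !chain_idemM !min0n subrr.
Qed.

Lemma jst1 : Phi 1 = 1.
Proof.
apply/esym/eqP; rewrite -subr_eq0; apply/eqP/(@chain_max 1%g) => k.
rewrite mulrBl mul1r mulrBr.
by have [-> _] := Phi_unit (E_smr [set i | ((1 : {perm 'I_n})%g i < k.+1)%N]);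
   have [-> _] := Phi_unit (E_smr [set i | ((1 : {perm 'I_n})%g i < k)%N]); rewrite subrr.
Qed.

Lemma jst_unit_idem_corner k (A : 'M[D]_n) :
  let p := Phi (delta_mx k k) in p * A * p != 0 -> exists B, p * A * p * B = p.
Proof.
(* The transposition puts k first, so the first step of this chain is
   [Phi (delta_mx k k) - Phi 0]. *)
pose o := Ordinal n_ge1; pose s := tperm k o.
have dE: chain_step s o = Phi (delta_mx k k).
  rewrite /chain_step (_ : [set i | (s i < o)%N] = set0); last by apply/setP => i; rewrite !inE.
  rewrite coord_idem0 jst0 subr0 -coord_idem1; congr (Phi (E _)).
  apply/setP => i; rewrite !inE ltnS leqn0 -(inj_eq (@perm_inj _ s)) tpermL.
  by rewrite -(inj_eq val_inj).
rewrite -dE.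
exact: (orthogonal_idempotent_corner_inv D_div (chain_step_neq0 s) (chain_step_orth s)).
Qed.

Let delta_smr i : delta_mx i i \in P := smr_pred_delta D (r_refl i).

Let aunit a i : a *: delta_mx i i \in P := smr_predZ_delta a (r_refl i).

(* With x = e + a f and L = phi(a f), one finds phi(e) L = phi(e) phi(f) for every
   unit a; if a <> 1, then phi(f) - L is a nonzero, hence invertible, element of
   the corner of the primitive idempotent phi(f), so phi(e) phi(f) = 0. *)
Lemma jst_orth (k l : 'I_n) : k != l -> Phi (delta_mx k k) * Phi (delta_mx l l) = 0.
Proof.
move=> ne_kl; have [a a0 a1] := D_gt2.
have aU: a \is a GRing.unit by apply: D_div.
pose e : 'M[D]_n := delta_mx k k; pose f : 'M[D]_n := delta_mx l l.
pose x := e + a *: f; pose L := Phi (a *: f).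
have eE : e = 1 *: delta_mx k k by rewrite scale1r.
have fE : f = 1 *: delta_mx l l by rewrite scale1r.
have [eP fP] : e \in P /\ f \in P by split; apply: delta_smr.
have xP : x \in P := smr_predD eP (aunit a l).
have [lk kl]: (l == k) = false /\ (k == l) = false by rewrite eq_sym (negbTE ne_kl).
have mulE := (mul_delta, eqxx, lk, kl, mulr0, mul0r, mulr1, mul1r, addr0, add0r).
have XpX : Phi x * Phi e * Phi x = Phi e.
  by rewrite -Phi_jst //; congr Phi; rewrite /x !mulrDl !mulrDr eE fE ?scalerA !mulE.
have pXp : Phi e * Phi x * Phi e = Phi e.
  by rewrite -Phi_jst //; congr Phi; rewrite /x !mulrDr !mulrDl eE fE ?scalerA !mulE.
have pp : Phi e * Phi e = Phi e.
  by rewrite -jst_sqr // eE !mulE.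
have qq : Phi f * Phi f = Phi f.
  by rewrite -jst_sqr // fE !mulE.
have pX : Phi e * Phi x = Phi e.
  by rewrite -{1}pXp -!mulrA (mulrA (Phi x)) XpX pp.
have qXq : Phi f * Phi x * Phi f = L.
  by rewrite -Phi_jst //; congr Phi; rewrite /x !mulrDr !mulrDl eE fE ?scalerA !mulE.
have XqX : Phi x * Phi f * Phi x = L * L.
  rewrite -jst_sqr ?aunit // -Phi_jst //; congr Phi.
  by rewrite /x !mulrDl !mulrDr eE fE ?scalerA !mulE.
have qLq : Phi f * L * Phi f = L.
  by rewrite -Phi_jst ?aunit //; congr Phi; rewrite fE ?scalerA !mulE.
have qL : Phi f * L = L by rewrite -{1}qLq !mulrA qq qLq.
have Lq : L * Phi f = L by rewrite -{1}qLq -!mulrA qq mulrA qLq.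
(* [Phi e * Phi x * Phi f * Phi x * Phi f] is evaluated with two bracketings. *)
have pLL : Phi e * L * L = Phi e * L.
  have: Phi e * (Phi x * Phi f * Phi x) * Phi f = Phi e * L.
    by rewrite !mulrA pX -!mulrA (mulrA (Phi f)) qXq.
  by rewrite XqX -!mulrA Lq !mulrA.
(* The coefficient a^-2 solves a y a = 1; the resulting K cancels one L from [pLL]. *)
have [K LKL] : exists K, L * K * L = Phi f.
  exists (Phi ((a^-1 * a^-1) *: f)).
  rewrite -Phi_jst ?aunit //; congr Phi; rewrite fE ?scalerA !mulE.
  by rewrite !mulrA mulrV // mul1r mulVr.
have pL : Phi e * L = Phi e * Phi f.
  by rewrite -[in RHS]LKL !mulrA -[X in _ = X * K * L]pLL -!mulrA (mulrA L K L) LKL Lq.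
have ne_qL : Phi f * (1 - L) * Phi f != 0.
  rewrite mulrBr mulr1 mulrBl qq qLq subr_eq0; apply: contra_neq a1.
  move=> /(Phi_inj (delta_smr _) (aunit _ _))/matrixP/(_ l l).
  by rewrite !mxE !eqxx mulr1.
have [B qLB] := jst_unit_idem_corner ne_qL.
rewrite -qLB mulrBr mulr1 mulrBl qq qLq mulrA mulrBr pL subrr mul0r //.
Qed.

Lemma jst_delta_neq0 k : Phi (delta_mx k k) != 0.
Proof.
have zero_smr : (0 : 'M[D]_n) \in P by apply/smr_predP => i j; rewrite mxE.
rewrite -jst0; apply/eqP => /(Phi_inj (delta_smr _) zero_smr)/matrixP/(_ k k)/eqP.
by rewrite !mxE !eqxx oner_eq0.
Qed.

Lemma jst_delta_orth k l :
  Phi (delta_mx k k) * Phi (delta_mx l l) = if k == l then Phi (delta_mx k k) else 0.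
Proof.
case: eqVneq => [<-|]; last exact: jst_orth.
by rewrite -jst_sqr // -[delta_mx _ _]scale1r mul_delta eqxx mul1r.
Qed.

End UnitalJordanSemiTriple.

(** * A functional equation for triangular 2 x 2 blocks *)

(* F a b c stands for the off-diagonal entry of the image of [[a, b], [0, c]], and
   s1 a, s2 c for the diagonal ones. The codomain E will be D, or the converse
   ring D^c when the image is lower triangular. *)
Section TriangularFunctionalEquation.

Variables (D E : unitRingType) (D_div : GRing.field_axiom D) (E_div : GRing.field_axiom E).
Variables (s1 s2 : D -> E) (F : D -> D -> D -> E).
Hypotheses (s1_0 : s1 0 = 0) (s1_1 : s1 1 = 1) (s2_0 : s2 0 = 0) (s2_1 : s2 1 = 1).
Hypothesis F_diag : forall a c, F a 0 c = 0.
Hypothesis F_jst : forall a b c a' b' c',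
  F (a * a' * a) (a * a' * b + a * b' * c + b * c' * c) (c * c' * c) =
  s1 a * s1 a' * F a b c + s1 a * F a' b' c' * s2 c + F a b c * s2 c' * s2 c.
Hypotheses (F010 : F 0 1 0 != 0) (F111 : F 1 1 1 != 0).

Let simp := (mulr0, mul0r, mulr1, mul1r, addr0, add0r, F_diag, s1_0, s1_1, s2_0, s2_1).

Lemma tri_nilM a b c : F 0 (a * b * c) 0 = s1 a * F 0 b 0 * s2 c.
Proof. by have := F_jst a 0 c 0 b 0; rewrite !simp. Qed.

Lemma tri_nilEl b : F 0 b 0 = s1 b * F 0 1 0.
Proof. by have := tri_nilM b 1 1; rewrite !simp. Qed.

Lemma tri_nilEr b : F 0 b 0 = F 0 1 0 * s2 b.
Proof. by have := tri_nilM 1 1 b; rewrite !simp. Qed.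

Lemma tri_diag1M : {morph s1 : a b / a * b}.
Proof.
move=> a b; apply: (mulIr (E_div F010)).
by rewrite -tri_nilEl -[a * b]mulr1 tri_nilM s2_1 mulr1 tri_nilEl mulrA.
Qed.

Lemma tri_diag2M : {morph s2 : a b / a * b}.
Proof.
move=> a b; apply: (mulrI (E_div F010)).
by rewrite -tri_nilEr -[a * b]mul1r mulrA tri_nilM s1_1 mul1r tri_nilEr mulrA.
Qed.

(** With y = [[a^-1, 0], [0, 0]] the product x y x keeps a and b and erases c, while s1 a s1 (a^-1)
    = 1 leaves [F a b c] on the other side. *)
Lemma tri_cancel2 a b c : a != 0 -> F a b c = F a b 0.
Proof.
move=> /D_div aU; have := F_jst a b c a^-1 0 0.
by rewrite -tri_diag1M mulrV // !simp.
Qed.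

Lemma tri_cancel1 a b c : c != 0 -> F a b c = F 0 b c.
Proof.
move=> /D_div cU; have := F_jst a b c 0 0 c^-1.
by rewrite -[F a b c * _ * _]mulrA -tri_diag2M mulVr // -[b * _ * _]mulrA mulVr // mulrV // !simp.
Qed.

(** If a is nonzero, c can be replaced by 0 and then by 1, after which a can be replaced in the same
    way; nonzero c is symmetric. *)
Lemma tri_unipotentE a b c : (a != 0) || (c != 0) -> F a b c = F 1 b 1.
Proof.
have n1 := oner_neq0 D.
case/orP => [a0|c0].
  by rewrite tri_cancel2 // -(tri_cancel2 b 1 a0) tri_cancel1 // -(tri_cancel1 1).
by rewrite tri_cancel1 // -(tri_cancel1 1 b c0) tri_cancel2 // -(tri_cancel2 b 1).
Qed.

(** The middle factor [[1, b'], [0, 0]] has a zero corner so that b occurs only once in x y x; a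
    unipotent one would give 2 b + b'. *)
Lemma tri_unipotentD : {morph (fun b => F 1 b 1) : b b' / b + b'}.
Proof.
move=> b b'; have := F_jst 1 b 1 1 b' 0; rewrite !simp.
by rewrite !(@tri_unipotentE 1 _ 0) ?oner_neq0.
Qed.

Lemma tri_unipotentEl b : F 1 b 1 = s1 b * F 1 1 1.
Proof.
have [->|b0] := eqVneq b 0; first by rewrite !simp.
have := F_jst b 0 1 1 1 1; rewrite !simp => <-.
by rewrite tri_unipotentE ?oner_neq0 ?orbT.
Qed.

Lemma tri_unipotentEr b : F 1 b 1 = F 1 1 1 * s2 b.
Proof.
have [->|b0] := eqVneq b 0; first by rewrite !simp.
have := F_jst 1 0 b 1 1 1; rewrite !simp => <-.
by rewrite tri_unipotentE ?oner_neq0.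
Qed.

Lemma tri_diag1D : {morph s1 : a b / a + b}.
Proof.
move=> a b; apply: (mulIr (E_div F111)).
by rewrite mulrDl -!tri_unipotentEl tri_unipotentD.
Qed.

Lemma tri_diag2D : {morph s2 : a b / a + b}.
Proof.
move=> a b; apply: (mulrI (E_div F111)).
by rewrite mulrDr -!tri_unipotentEr tri_unipotentD.
Qed.

Lemma tri_nilD : {morph (fun b => F 0 b 0) : b b' / b + b'}.
Proof.
move=> b b'; rewrite /= (tri_nilEl (b + b')) (tri_nilEl b) (tri_nilEl b').
by rewrite tri_diag1D mulrDl.
Qed.

Lemma tri_nil_unipotent b : F 0 1 0 = F 1 1 1 -> F 0 b 0 = F 1 b 1.
Proof. by move=> eqF; rewrite tri_nilEl eqF -tri_unipotentEl. Qed.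

End TriangularFunctionalEquation.

(** * Maps fixing every diagonal matrix unit *)

Section DiagonalJordanSemiTriple.

Variables (D : unitRingType) (D_div : GRing.field_axiom D).
Variables (n : nat) (r : rel 'I_n).
Hypotheses (r_refl : reflexive r) (r_trans : transitive r).

Local Notation P := (@smr_pred D n r).
Local Notation E := (@coord_idem D n).

Variable Phi : 'M[D]_n -> 'M[D]_n.
Hypothesis Phi_inj : {in P &, injective Phi}.
Hypothesis Phi_jst : {in P &, forall x y, Phi (x * y * x) = Phi x * Phi y * Phi x}.
Hypotheses (Phi_0 : Phi 0 = 0) (Phi_1 : Phi 1 = 1).
Hypothesis Phi_delta : forall k, Phi (delta_mx k k) = delta_mx k k.

Let mul_eq0 := @division_mul_eq0 D D_div.
Let E_smr S : E S \in P := coord_idem_smr D r_refl S.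
Let aunit a i : a *: delta_mx i i \in P := smr_predZ_delta a (r_refl i).
Let delta_smr i : delta_mx i i \in P := smr_pred_delta D (r_refl i).

Lemma coord_idem_compress (S : {set 'I_n}) (A : 'M[D]_n) i j :
  (E S * A * E S) i j = if (i \in S) && (j \in S) then A i j else 0.
Proof.
rewrite -!mulmxE mul_mx_diag mxE mul_diag_mx !mxE.
by case: (i \in S); case: (j \in S); rewrite ?(mulr0, mul0r, mul1r, mulr1).
Qed.

(* For an idempotent e, phi(e) = phi(e) 1 phi(e) = sum_k phi(e E_kk e). *)
Lemma diag_coord_idem (S : {set 'I_n}) : Phi (E S) = E S.
Proof.
have EM T : E T * E T = E T by rewrite coord_idemM setIid.
have PE : Phi (E S) * Phi (E S) = Phi (E S).
  by rewrite -{3}EM -{3}[E S]mulr1 Phi_jst ?Phi_1 ?mulr1 // (smr_pred1 D r_refl r_trans).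
have sum1 : (1 : 'M[D]_n) = \sum_k E [set k].
  apply/matrixP => i j; rewrite summxE !mxE (bigD1 i) //= big1 => [|k ne_ki].
    by rewrite !mxE set11 addr0.
  by rewrite !mxE inE eq_sym (negbTE ne_ki) mul0rn.
rewrite -PE -{1}[Phi (E S)]mulr1 -[RHS]EM -[X in _ = X * _]mulr1 sum1.
rewrite !mulr_sumr !mulr_suml; apply: eq_bigr => k _.
rewrite coord_idem1 -{1}Phi_delta -Phi_jst // -coord_idem1 !coord_idemM.
rewrite setIC setIA setIid; have [kS|nkS] := boolP (k \in S).
  by rewrite (setIidPr _) ?sub1set // coord_idem1 Phi_delta.
rewrite (_ : S :&: [set k] = set0) ?coord_idem0 ?Phi_0 //.
by apply/setP => i; rewrite !inE; case: eqP => [->|]; rewrite ?andbF // (negbTE nkS).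
Qed.

Lemma diag_compress S x : x \in P -> Phi (E S * x * E S) = E S * Phi x * E S.
Proof. by move=> xP; rewrite Phi_jst // diag_coord_idem. Qed.

(** [Phi] commutes with compression to {i, j}, and these four entries determine the compression. *)
Lemma diag_local x y i j : x \in P -> y \in P ->
  x i i = y i i -> x i j = y i j -> x j i = y j i -> x j j = y j j ->
  Phi x i j = Phi y i j.
Proof.
move=> xP yP ii ij ji jj; pose S := [set i; j].
have <- : (E S * Phi x * E S) i j = Phi x i j.
  by rewrite coord_idem_compress !inE !eqxx orbT.
have <- : (E S * Phi y * E S) i j = Phi y i j.
  by rewrite coord_idem_compress !inE !eqxx orbT.
rewrite -!diag_compress //; congr (Phi _ i j); apply/matrixP => k l.
rewrite !coord_idem_compress !inE.
by case: eqVneq => [->|_]; case: eqVneq => [->|_] //=; case: eqVneq => [->|_] //=;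
   case: eqVneq => [->|_].
Qed.

Definition diag_fun i a := Phi (a *: delta_mx i i) i i.
Local Notation s := diag_fun.

Lemma diag_entry x i : x \in P -> Phi x i i = s i (x i i).
Proof. by move=> xP; apply: diag_local; rewrite // !mxE !eqxx mulr1. Qed.

Lemma diag_fun0 i : s i 0 = 0.
Proof. by rewrite /s scale0r Phi_0 mxE. Qed.

Lemma diag_fun1 i : s i 1 = 1.
Proof. by rewrite /s scale1r Phi_delta mxE !eqxx. Qed.

Lemma diag_delta i a : Phi (a *: delta_mx i i) = s i a *: delta_mx i i.
Proof.
have -> : a *: delta_mx i i = E [set i] * (a *: delta_mx i i) * E [set i].
  apply/matrixP => k l; rewrite coord_idem_compress !mxE !inE.
  by case: (k == i); case: (l == i); rewrite /= ?mulr0.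
rewrite diag_compress //; apply/matrixP => k l; rewrite coord_idem_compress !mxE !inE.
by case: eqVneq => [->|_]; case: eqVneq => [->|_]; rewrite /= ?(mulr0, mulr1).
Qed.

Lemma diag_fun_inj i : injective (s i).
Proof.
move=> a b eq_ab; have /(Phi_inj (aunit a i) (aunit b i))/matrixP/(_ i i) :
  Phi (a *: delta_mx i i) = Phi (b *: delta_mx i i) by rewrite !diag_delta eq_ab.
by rewrite !mxE !eqxx !mulr1.
Qed.

Lemma diag_funM i a b : s i (a * b * a) = s i a * s i b * s i a.
Proof.
rewrite /s [in RHS]diag_delta.
have -> : (a * b * a) *: delta_mx i i =
    a *: delta_mx i i * (b *: delta_mx i i) * (a *: delta_mx i i).
  by rewrite !(mul_delta, eqxx).
by rewrite Phi_jst // !diag_delta !(mul_delta, eqxx) !mxE !eqxx !mulr1.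
Qed.

Lemma diag_fun_neq0 i a : a != 0 -> s i a != 0.
Proof. by apply: contra_neq; rewrite -{1}(diag_fun0 i) => /diag_fun_inj. Qed.

(** By locality x may be replaced by y = x_ii E_ii + x_jj E_jj. For k in {i, j}, y E_kk y is a
    multiple of E_kk, so [Phi y i k * Phi y k j = 0]. If x_kk is nonzero, the diagonal factor
    cancels and leaves the wanted entry; if both x_ii and x_jj vanish, y = 0. *)
Lemma diag_offdiag0 x i j : x \in P -> i != j -> x i j = 0 -> x j i = 0 -> Phi x i j = 0.
Proof.
move=> xP ne_ij xij xji; have ne_ji : j != i by rewrite eq_sym.
pose y : 'M[D]_n := x i i *: delta_mx i i + x j j *: delta_mx j j.
have yP : y \in P := smr_predD (aunit _ _) (aunit _ _).
have -> : Phi x i j = Phi y i j.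
  apply: diag_local => //;
  by rewrite !mxE ?eqxx ?(negbTE ne_ij) ?(negbTE ne_ji) ?andbF ?(mulr1, mulr0, addr0, add0r).
have yii k : y * delta_mx k k * y \in P by rewrite !smr_predM.
have prod k : k \in [set i; j] -> y k k = x k k -> Phi y i k * Phi y k j = 0.
  move=> kS ykk; rewrite -[Phi y i k]mulr1 -mul_delta_mul scale1r -{1}Phi_delta -Phi_jst //.
  have -> : y * delta_mx k k * y = (x k k * x k k) *: delta_mx k k.
    rewrite /y -[delta_mx k k in LHS]scale1r.
    move: kS; rewrite !inE => /orP[]/eqP->;
    by rewrite !(mulrDl, mulrDr, mul_delta, eqxx, negbTE ne_ij, negbTE ne_ji,
                 mul0r, addr0, add0r, mulr1).
  rewrite diag_delta !mxE (_ : _ && _ = false) ?mulr0 //.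
  by apply: contraNF ne_ij => /andP[/eqP-> /eqP->].
have yE k : k \in [set i; j] -> y k k = x k k.
  rewrite !inE => /orP[]/eqP->; rewrite !mxE !eqxx ?(negbTE ne_ij) ?(negbTE ne_ji);
  by rewrite ?(mulr1, mulr0, addr0, add0r).
have [iS jS]: i \in [set i; j] /\ j \in [set i; j] by rewrite !inE !eqxx orbT.
have [xi0|xi0] := eqVneq (x i i) 0; last first.
  have := prod i iS (yE i iS); rewrite diag_entry // yE //.
  move=> /(congr1 (fun z => (s i (x i i))^-1 * z)).
  by rewrite mulr0 mulrA mulVr ?mul1r //; apply/D_div/diag_fun_neq0.
have [xj0|xj0] := eqVneq (x j j) 0; last first.
  have := prod j jS (yE j jS); rewrite (diag_entry j) // yE //.
  move=> /(congr1 (fun z => z * (s j (x j j))^-1)).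
  by rewrite mul0r -mulrA mulrV ?mulr1 //; apply/D_div/diag_fun_neq0.
by rewrite /y xi0 xj0 !scale0r addr0 Phi_0 mxE.
Qed.

(** * A comparable pair: triangular blocks and their images *)

Section ComparablePair.

Variables (i j : 'I_n).
Hypotheses (ne_ij : i != j) (r_ij : r i j).

Definition block (a b c d : D) : 'M[D]_n :=
  a *: delta_mx i i + b *: delta_mx i j + c *: delta_mx j i + d *: delta_mx j j.

Definition tri (a b c : D) := block a b 0 c.

Let ne_ji : j != i. Proof. by rewrite eq_sym. Qed.

Lemma block_entries a b c d :
  [/\ block a b c d i i = a, block a b c d i j = b, block a b c d j i = c & block a b c d j j = d].
Proof.
by split; rewrite !mxE ?eqxx ?(negbTE ne_ij) ?(negbTE ne_ji) /= ?(mulr0, mulr1, addr0, add0r).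
Qed.

Lemma block_inj a b c d a' b' c' d' :
  block a b c d = block a' b' c' d' -> [/\ a = a', b = b', c = c' & d = d'].
Proof.
by have [+ + + +] := block_entries a b c d => + + + + eqb; rewrite eqb;
   have [-> -> -> ->] := block_entries a' b' c' d'.
Qed.

Lemma blockM a b c d a' b' c' d' :
  block a b c d * block a' b' c' d' =
  block (a * a' + b * c') (a * b' + b * d') (c * a' + d * c') (c * b' + d * d').
Proof.
rewrite /block !mulrDl !mulrDr !mul_delta !eqxx (negbTE ne_ij) (negbTE ne_ji).
rewrite /= !(addr0, add0r) !scalerDl.
by rewrite -addrA (addrACA ((c * a') *: _)) (addrACA ((a * a') *: _)) !addrA.
Qed.

Lemma block_compress (A : 'M[D]_n) :
  E [set i; j] * A * E [set i; j] = block (A i i) (A i j) (A j i) (A j j).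
Proof.
apply/matrixP => k l; rewrite coord_idem_compress !inE !mxE.
have [->|_] := eqVneq k i; [|have [->|_] := eqVneq k j];
(have [->|_] := eqVneq l i; [|have [->|_] := eqVneq l j]);
by rewrite ?eqxx ?(negbTE ne_ij) ?(negbTE ne_ji) /= ?(mulr0, mulr1, addr0, add0r).
Qed.

Lemma tri_smr a b c : tri a b c \in P.
Proof.
rewrite /tri /block scale0r addr0; apply/smr_predD/aunit.
by apply/smr_predD/smr_predZ_delta.
Qed.

Let F a b c := Phi (tri a b c) i j.
Let W a b c := Phi (tri a b c) j i.

Lemma diag_tri a b c : Phi (tri a b c) = block (s i a) (F a b c) (W a b c) (s j c).
Proof.
have tT : tri a b c = E [set i; j] * tri a b c * E [set i; j].
  by rewrite block_compress; have [-> -> -> ->] := block_entries a b 0 c.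
rewrite {1}tT diag_compress ?tri_smr // block_compress !diag_entry ?tri_smr //.
by have [-> _ _ ->] := block_entries a b 0 c.
Qed.

Lemma triM a b c a' b' c' :
  tri a b c * tri a' b' c' * tri a b c =
  tri (a * a' * a) (a * a' * b + a * b' * c + b * c' * c) (c * c' * c).
Proof. by rewrite /tri !blockM !(mulr0, mul0r, addr0, add0r) mulrDl addrA. Qed.

Lemma diag_triM a b c a' b' c' :
  Phi (tri (a * a' * a) (a * a' * b + a * b' * c + b * c' * c) (c * c' * c)) =
  Phi (tri a b c) * Phi (tri a' b' c') * Phi (tri a b c).
Proof. by rewrite -triM Phi_jst ?tri_smr. Qed.

Lemma diag_tri_diag a c : Phi (tri a 0 c) = block (s i a) 0 0 (s j c).
Proof.
rewrite diag_tri /F /W; have [_ ij ji _] := block_entries a 0 0 c.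
by rewrite !diag_offdiag0 ?tri_smr.
Qed.

Lemma diag_tri_nilM a b c :
  F 0 (a * b * c) 0 = s i a * F 0 b 0 * s j c /\ W 0 (a * b * c) 0 = s j c * W 0 b 0 * s i a.
Proof.
have := diag_triM a 0 c 0 b 0; rewrite !(mulr0, mul0r, addr0, add0r).
rewrite diag_tri_diag !diag_tri !blockM !diag_fun0 !(mulr0, mul0r, addr0, add0r).
by case/block_inj.
Qed.

(** From E_ij (E_ii + E_jj) E_ij = 0 the product of the two entries is zero; they cannot both
    vanish, since [Phi] separates E_ij from 0. *)
Lemma diag_tri_nil_dichotomy :
  (F 0 1 0 != 0 /\ W 0 1 0 = 0) \/ (W 0 1 0 != 0 /\ F 0 1 0 = 0).
Proof.
have FW : F 0 1 0 * W 0 1 0 = 0.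
  have := diag_triM 0 1 0 1 0 1; rewrite !(mulr0, mul0r, mulr1, mul1r, addr0, add0r).
  rewrite !diag_tri_diag diag_tri !blockM !diag_fun0 !diag_fun1.
  by rewrite !(mulr0, mul0r, mulr1, mul1r, addr0, add0r) => /block_inj[].
have [F0|F0] := eqVneq (F 0 1 0) 0; last first.
  by left; case: (mul_eq0 FW) => // /eqP; rewrite (negbTE F0).
right; split=> //; apply/eqP => W0.
have /(Phi_inj (tri_smr _ _ _) (tri_smr _ _ _)) : Phi (tri 0 1 0) = Phi (tri 0 0 0).
  by rewrite diag_tri_diag diag_tri F0 W0.
by case/block_inj => _ /eqP; rewrite oner_eq0.
Qed.

(* phi maps the block {i, j} into triangular matrices with off-diagonal entry at
   (k, l), which is either (i, j) or (j, i). *)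
Record pair_form (k l : 'I_n) : Prop := PairForm {
  pair_zero : forall a b c, Phi (tri a b c) l k = 0;
  pair_nil_neq0 : Phi (tri 0 1 0) k l != 0;
  pair_nilD : {morph (fun b => Phi (tri 0 b 0) k l) : b b' / b + b'};
  pair_uniD : {morph (fun b => Phi (tri 1 b 1) k l) : b b' / b + b'};
  pair_uniE : forall a b c, (a != 0) || (c != 0) -> Phi (tri a b c) k l = Phi (tri 1 b 1) k l;
  pair_nil_uni : forall b, Phi (tri 0 1 0) k l = Phi (tri 1 1 1) k l ->
    Phi (tri 0 b 0) k l = Phi (tri 1 b 1) k l
}.

(** The place of the nonzero entry of the image of E_ij decides the shape of the whole block: the
    opposite entry vanishes identically, and the remaining one solves the functional equation, over
    D or over its converse. *)
Lemma diag_pair_form :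
  [/\ {morph s i : a b / a + b}, {morph s j : a b / a + b} & pair_form i j \/ pair_form j i].
Proof.
have FW_diag a c : F a 0 c = 0 /\ W a 0 c = 0.
  by rewrite /F /W diag_tri_diag; have [_ -> ->] := block_entries (s i a) 0 0 (s j c).
have uni_neq0 : ~ (F 1 1 1 = 0 /\ W 1 1 1 = 0).
  case=> F0 W0; have /(Phi_inj (tri_smr _ _ _) (tri_smr _ _ _)) : Phi (tri 1 1 1) = Phi (tri 1 0 1).
    by rewrite diag_tri_diag diag_tri F0 W0.
  by case/block_inj => _ /eqP; rewrite oner_eq0.
have [[F1 W1]|[W1 F1]] := diag_tri_nil_dichotomy.
  (* Since x E_ij x = a c E_ij, whose image vanishes at (j, i), the product
     [W a b c * F 0 1 0 * W a b c] is zero. *)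
  have W0 a b c : W a b c = 0.
    have := diag_triM a b c 0 1 0; rewrite !(mulr0, mul0r, mulr1, mul1r, addr0, add0r).
    have [_] := diag_tri_nilM a 1 c; rewrite W1 mulr1 mulr0 mul0r => W0.
    rewrite !diag_tri W0 !blockM !W1 !diag_fun0 !(mulr0, mul0r, addr0, add0r) => /block_inj[_ _ + _].
    move=> /esym/mul_eq0[/mul_eq0[]|] // /eqP.
    by rewrite (negbTE F1).
  have F_jst a b c a' b' c' :
      F (a * a' * a) (a * a' * b + a * b' * c + b * c' * c) (c * c' * c) =
      s i a * s i a' * F a b c + s i a * F a' b' c' * s j c + F a b c * s j c' * s j c.
    have := diag_triM a b c a' b' c'; rewrite !diag_tri !W0 !blockM.
    by rewrite !(mulr0, mul0r, addr0, add0r) => /block_inj[_ -> _ _]; rewrite mulrDl addrA.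
  have F2 : F 1 1 1 != 0 by apply/eqP => F0; apply: uni_neq0.
  have Fd a c : F a 0 c = 0 by have [] := FW_diag a c.
  split.
  - exact: (tri_diag1D D_div D_div (diag_fun0 i) (diag_fun1 i)
      (diag_fun0 j) (diag_fun1 j) Fd F_jst F1 F2).
  - exact: (tri_diag2D D_div D_div (diag_fun0 i) (diag_fun1 i)
      (diag_fun0 j) (diag_fun1 j) Fd F_jst F1 F2).
  left; split => //.
  - exact: (tri_nilD D_div D_div (diag_fun0 i) (diag_fun1 i)
      (diag_fun0 j) (diag_fun1 j) Fd F_jst F1 F2).
  - exact: (tri_unipotentD D_div D_div (diag_fun0 i) (diag_fun1 i)
      (diag_fun0 j) (diag_fun1 j) Fd F_jst F1).
  - exact: (tri_unipotentE D_div D_div (diag_fun0 i) (diag_fun1 i)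
      (diag_fun0 j) (diag_fun1 j) Fd F_jst F1).
  - exact: (tri_nil_unipotent D_div D_div (diag_fun0 i) (diag_fun1 i)
      (diag_fun0 j) (diag_fun1 j) Fd F_jst F1).
have F0 a b c : F a b c = 0.
  have := diag_triM a b c 0 1 0; rewrite !(mulr0, mul0r, mulr1, mul1r, addr0, add0r).
  have [+ _] := diag_tri_nilM a 1 c; rewrite F1 mulr1 mulr0 mul0r => F0.
  rewrite !diag_tri F0 !blockM !F1 !diag_fun0 !(mulr0, mul0r, addr0, add0r) => /block_inj[_ + _ _].
  move=> /esym/mul_eq0[/mul_eq0[]|] // /eqP.
  by rewrite (negbTE W1).
(* The images are now lower triangular and their entries multiply in reverse order; read in [D^c],
   they satisfy the same equation. *)
pose si : D -> D^c := s i; pose sj : D -> D^c := s j; pose G : D -> D -> D -> D^c := W.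
have Dc_div : GRing.field_axiom (D^c) by exact: D_div.
have G_jst a b c a' b' c' :
    G (a * a' * a) (a * a' * b + a * b' * c + b * c' * c) (c * c' * c) =
    si a * si a' * G a b c + si a * G a' b' c' * sj c + G a b c * sj c' * sj c.
  have := diag_triM a b c a' b' c'; rewrite !diag_tri !F0 !blockM.
  rewrite !(mulr0, mul0r, addr0, add0r) => /block_inj[_ _ WE _].
  rewrite -[RHS]/(W a b c * (s i a' * s i a) + s j c * (W a' b' c' * s i a) +
                  s j c * (s j c' * W a b c)).
  by rewrite /G WE mulrDl !mulrA.
have G2 : G 1 1 1 != 0 by apply/eqP => G0; apply: uni_neq0.
have Gd a c : G a 0 c = 0 by have [] := FW_diag a c.
split.
- exact: (tri_diag1D D_div Dc_div (diag_fun0 i) (diag_fun1 i)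
    (diag_fun0 j) (diag_fun1 j) Gd G_jst W1 G2).
- exact: (tri_diag2D D_div Dc_div (diag_fun0 i) (diag_fun1 i)
    (diag_fun0 j) (diag_fun1 j) Gd G_jst W1 G2).
right; split => //.
- exact: (tri_nilD D_div Dc_div (diag_fun0 i) (diag_fun1 i)
    (diag_fun0 j) (diag_fun1 j) Gd G_jst W1 G2).
- exact: (tri_unipotentD D_div Dc_div (diag_fun0 i) (diag_fun1 i)
    (diag_fun0 j) (diag_fun1 j) Gd G_jst W1).
- exact: (tri_unipotentE D_div Dc_div (diag_fun0 i) (diag_fun1 i)
    (diag_fun0 j) (diag_fun1 j) Gd G_jst W1).
- exact: (tri_nil_unipotent D_div Dc_div (diag_fun0 i) (diag_fun1 i)
    (diag_fun0 j) (diag_fun1 j) Gd G_jst W1).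
Qed.

End ComparablePair.

(** * From pairs to additivity of every entry *)

Lemma diag_entry0 x a b : x \in P -> x a b = 0 -> x b a = 0 -> Phi x a b = 0.
Proof.
move=> xP ab ba; have [eq_ab|ne_ab] := eqVneq a b; last exact: diag_offdiag0.
by move: ab; rewrite -eq_ab diag_entry // => ->; rewrite diag_fun0.
Qed.

Lemma tri_nilE i j b : tri i j 0 b 0 = b *: delta_mx i j.
Proof. by rewrite /tri /block !scale0r !addr0 add0r. Qed.

(* For m <= i <= j take x = E_mi + E_jj: then x y x = E_mj both for y = E_ij and for
   y = E_ii + E_ij; j <= m is dual. For i <= m <= j take x = E_ii + E_im + E_mj and
   compare x E_mm x = E_ij with x (E_mm + E_ii) x = E_ii + E_im + E_ij. *)
Lemma nonisolated_nil_unipotent i j k l : i != j -> r i j ->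
  pair_form i j k l -> (k, l) = (i, j) \/ (k, l) = (j, i) -> nonisolated r i j ->
  Phi (tri i j 0 1 0) k l = Phi (tri i j 1 1 1) k l.
Proof.
move=> ne_ij r_ij fkl kl_ij [m [ne_mi ne_mj r_m]].
have [ne_ji ne_im ne_jm] : [/\ j != i, i != m & j != m] by rewrite !(eq_sym _ m) eq_sym.
have neE := (negbTE ne_ij, negbTE ne_ji, negbTE ne_mi, negbTE ne_im, negbTE ne_mj, negbTE ne_jm).
have n1 := oner_neq0 D.
have nilE : tri i j 0 1 0 = delta_mx i j by rewrite tri_nilE scale1r.
have rP a b : r a b -> (delta_mx a b : 'M[D]_n) \in P by apply: smr_pred_delta.
have mulE (a b c d : 'I_n) :
    (delta_mx a b * delta_mx c d : 'M[D]_n) = if b == c then delta_mx a d else 0.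
  by have := @mul_delta D n a b c d 1 1; rewrite mulr1 !scale1r.
pose mulsE := (mulrDl, mulrDr, mulE, eqxx, neE, addr0, add0r, mul0r, mulr0).
case: r_m => [[r_mi _]|[r_im r_mj]|[_ r_jm]].
- pose x : 'M[D]_n := delta_mx m i + delta_mx j j.
  have xP : x \in P by apply: smr_predD; apply: rP.
  have r_mj : r m j := r_trans r_mi r_ij.
  have xyx : x * tri i j 0 1 0 * x = delta_mx m j by rewrite nilE /x !mulsE.
  have xzx : x * tri i j 1 1 0 * x = delta_mx m j.
    by rewrite /tri /block !scale1r !scale0r !addr0 /x !mulsE.
  have Xjj : Phi x j j = 1.
    by rewrite diag_entry // !mxE !eqxx !neE add0r diag_fun1.
  have mj (Y : 'M[D]_n) : (Phi x * Y * Phi x) m j = Phi x m i * Y i j.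
    rewrite (@triple_entry D n _ _ m j i j) ?Xjj ?mulr1 // => c ne_c; apply: diag_entry0 => //;
    by rewrite !mxE ?eqxx ?neE ?(negbTE ne_c) ?andbF ?addr0.
  have jm (Y : 'M[D]_n) : (Phi x * Y * Phi x) j m = Y j i * Phi x i m.
    rewrite (@triple_entry D n _ _ j m j i) ?Xjj ?mul1r // => c ne_c; apply: diag_entry0 => //;
    by rewrite !mxE ?eqxx ?neE ?(negbTE ne_c) ?andbF ?addr0.
  have mjE : Phi x m i * Phi (tri i j 0 1 0) i j = Phi x m i * Phi (tri i j 1 1 0) i j.
    by rewrite -!mj -!Phi_jst ?tri_smr // xyx xzx.
  have jmE : Phi (tri i j 0 1 0) j i * Phi x i m = Phi (tri i j 1 1 0) j i * Phi x i m.
    by rewrite -!jm -!Phi_jst ?tri_smr // xyx xzx.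
  (* By the dichotomy for (m, j), the image of E_mj is nonzero at (m, j) or (j, m). With [pair_zero]
     this shows which entry of [Phi x] can be cancelled. *)
  have nz : ~ (Phi x m i * Phi (tri i j 0 1 0) i j = 0 /\ Phi (tri i j 0 1 0) j i * Phi x i m = 0).
    rewrite -mj -jm -Phi_jst ?tri_smr // xyx -[delta_mx m j]scale1r -tri_nilE => -[mj0 jm0].
    have := diag_tri_nil_dichotomy ne_mj r_mj.
    by rewrite mj0 jm0 eqxx => -[[]|[]].
  rewrite -(@pair_uniE _ _ _ _ fkl 1 1 0) ?n1 //.
  have := pair_zero fkl 0 1 0; case: kl_ij => -[-> ->] z0.
    apply: (mulrI _ mjE); apply: D_div; apply/eqP => X0.
    by apply: nz; rewrite X0 z0 !mul0r.
  apply: (mulIr _ jmE); apply: D_div; apply/eqP => X0.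
  by apply: nz; rewrite X0 z0 !mulr0.
- pose x : 'M[D]_n := delta_mx i i + delta_mx i m + delta_mx m j.
  have xP : x \in P by apply: smr_predD; [apply: smr_predD|]; apply: rP.
  pose z : 'M[D]_n := delta_mx i i + delta_mx i m + delta_mx i j.
  have zP : z \in P by apply: smr_predD; [apply: smr_predD|]; apply: rP.
  have imE : E [set i; m] = delta_mx i i + delta_mx m m.
    apply/matrixP => a b; rewrite !mxE !inE; have [<-|ne_ab] := eqVneq a b.
      rewrite !andbb; have [->|_] := eqVneq a i; first by rewrite neE addr0.
      by case: (a == m); rewrite add0r.
    by case: (eqVneq a i) => [<-|_]; case: (eqVneq a m) => [<-|_];
      rewrite ?(eq_sym b) ?(negbTE ne_ab) ?addr0.
  have xyx : x * delta_mx m m * x = delta_mx i j by rewrite /x !mulsE.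
  have xzx : x * E [set i; m] * x = z by rewrite imE /x /z !mulsE.
  (* [Phi] fixes both E_mm and E_ii + E_mm, so the middle factor splits additively. The extra term
     vanishes at (k, l) because [Phi x] vanishes at (i, j) and (j, i). *)
  have zE : Phi z = Phi (delta_mx i j) + Phi x * delta_mx i i * Phi x.
    rewrite -xzx -xyx !Phi_jst // ?rP // diag_coord_idem imE Phi_delta.
    by rewrite mulrDr mulrDl addrC.
  have Xij : Phi x i j = 0 /\ Phi x j i = 0.
    by split; apply: diag_entry0 => //; rewrite !mxE ?eqxx ?neE ?andbF /= ?addr0.
  have z0 : (Phi x * delta_mx i i * Phi x) k l = 0.
    rewrite -[delta_mx i i]scale1r mul_delta_mul.
    by case: kl_ij => -[-> ->]; case: Xij => Xij Xji; rewrite ?Xij ?Xji ?mulr0 ?mul0r.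
  rewrite -(@pair_uniE _ _ _ _ fkl 1 1 0) ?n1 // nilE -[LHS]addr0 -[X in _ + X = _]z0.
  have [ii ij ji jj] := block_entries ne_ij 1 1 0 0.
  have <- : Phi z k l = Phi (tri i j 1 1 0) k l.
    by case: kl_ij => -[-> ->]; apply: diag_local; rewrite ?tri_smr // /tri ?(ii, ij, ji, jj);
       rewrite !mxE !eqxx !neE ?addr0 ?add0r.
  by rewrite zE [RHS]mxE.
- pose x : 'M[D]_n := delta_mx j m + delta_mx i i.
  have xP : x \in P by apply: smr_predD; apply: rP.
  have r_im : r i m := r_trans r_ij r_jm.
  have xyx : x * tri i j 0 1 0 * x = delta_mx i m by rewrite nilE /x !mulsE.
  have xzx : x * tri i j 0 1 1 * x = delta_mx i m.
    by rewrite /tri /block !scale1r !scale0r add0r addr0 /x !mulsE.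
  have Xii : Phi x i i = 1.
    by rewrite diag_entry // !mxE !eqxx !neE add0r diag_fun1.
  have im (Y : 'M[D]_n) : (Phi x * Y * Phi x) i m = Y i j * Phi x j m.
    rewrite (@triple_entry D n _ _ i m i j) ?Xii ?mul1r // => c ne_c; apply: diag_entry0 => //;
    by rewrite !mxE ?eqxx ?neE ?(negbTE ne_c) ?andbF ?addr0.
  have mi (Y : 'M[D]_n) : (Phi x * Y * Phi x) m i = Phi x m j * Y j i.
    rewrite (@triple_entry D n _ _ m i j i) ?Xii ?mulr1 // => c ne_c; apply: diag_entry0 => //;
    by rewrite !mxE ?eqxx ?neE ?(negbTE ne_c) ?andbF ?addr0.
  have imE : Phi (tri i j 0 1 0) i j * Phi x j m = Phi (tri i j 0 1 1) i j * Phi x j m.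
    by rewrite -!im -!Phi_jst ?tri_smr // xyx xzx.
  have miE : Phi x m j * Phi (tri i j 0 1 0) j i = Phi x m j * Phi (tri i j 0 1 1) j i.
    by rewrite -!mi -!Phi_jst ?tri_smr // xyx xzx.
  have nz : ~ (Phi (tri i j 0 1 0) i j * Phi x j m = 0 /\ Phi x m j * Phi (tri i j 0 1 0) j i = 0).
    rewrite -im -mi -Phi_jst ?tri_smr // xyx -[delta_mx i m]scale1r -tri_nilE => -[im0 mi0].
    have := diag_tri_nil_dichotomy ne_im r_im.
    by rewrite im0 mi0 eqxx => -[[]|[]].
  rewrite -(@pair_uniE _ _ _ _ fkl 0 1 1) ?n1 ?orbT //.
  have := pair_zero fkl 0 1 0; case: kl_ij => -[-> ->] z0.
    apply: (mulIr _ imE); apply: D_div; apply/eqP => X0.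
    by apply: nz; rewrite X0 z0 !mulr0.
  apply: (mulrI _ miE); apply: D_div; apply/eqP => X0.
  by apply: nz; rewrite X0 z0 !mul0r.
Qed.

(* From E_ij y E_ij = y_ji E_ij. *)
Lemma diag_rev_entry i j k l : i != j -> r i j ->
  pair_form i j k l -> (k, l) = (i, j) \/ (k, l) = (j, i) -> forall y, y \in P ->
  Phi (tri i j 0 1 0) k l * Phi y l k * Phi (tri i j 0 1 0) k l = Phi (tri i j 0 (y j i) 0) k l.
Proof.
move=> ne_ij r_ij fkl kl_ij y yP; have ne_ji : j != i by rewrite eq_sym.
have -> : tri i j 0 (y j i) 0 = tri i j 0 1 0 * y * tri i j 0 1 0.
  apply/matrixP => a b; rewrite !tri_nilE scale1r (@triple_entry D n _ _ a b j i).
  - rewrite !mxE !eqxx andbT.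
    by case: (a == i); case: (b == j); rewrite /= ?(mul1r, mulr1, mulr0, mul0r).
  - by move=> c ne_c; rewrite mxE (negbTE ne_c) andbF.
  - by move=> c ne_c; rewrite mxE (negbTE ne_c).
rewrite Phi_jst ?tri_smr // (@triple_entry D n _ _ k l l k) // => c ne_c; apply: diag_entry0;
  rewrite ?tri_smr // tri_nilE !mxE; case: kl_ij ne_c => -[-> ->] ne_c;
  by rewrite ?eqxx ?(negbTE ne_ij, negbTE ne_ji, negbTE ne_c) ?andbF ?mulr0.
Qed.

(** If E_ij and E_ji were both sent to the place (k, l), the image of E_ji would vanish at (l, k),
    whereas [diag_rev_entry] with y = E_ji makes that entry nonzero. *)
Lemma symmetric_pair_sides i j k l k' l' : i != j -> r i j -> r j i ->
  pair_form i j k l -> (k, l) = (i, j) \/ (k, l) = (j, i) ->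
  pair_form j i k' l' -> (k', l') = (j, i) \/ (k', l') = (i, j) ->
  (k', l') = (l, k).
Proof.
move=> ne_ij r_ij r_ji fkl kl_ij fkl' kl_ji.
have := diag_rev_entry ne_ij r_ij fkl kl_ij (tri_smr r_ji 0 1 0).
have -> : tri j i 0 1 0 j i = 1 by rewrite tri_nilE !mxE !eqxx mulr1.
case: (boolP ((k', l') == (l, k))) => [/eqP //|ne E1].
case/eqP: (pair_nil_neq0 fkl); rewrite -E1.
have -> : Phi (tri j i 0 1 0) l k = 0; last by rewrite mulr0 mul0r.
have := pair_zero fkl' 0 1 0.
by case: kl_ij kl_ji ne => -[-> ->] [] [-> ->]; rewrite ?eqxx.
Qed.

(** By [diag_rev_entry], the entry (l, k) of [Phi y] is, between two invertible factors, the
    additive function of [pair_nilD] at y_ji. *)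
Lemma rev_entryD i j k l : i != j -> r i j ->
  pair_form i j k l -> (k, l) = (i, j) \/ (k, l) = (j, i) ->
  {in P &, {morph (fun x => Phi x l k) : x y / x + y}}.
Proof.
move=> ne_ij r_ij fkl kl_ij x y xP yP /=.
have tU := D_div (pair_nil_neq0 fkl); apply: (mulrI tU); apply: (mulIr tU).
rewrite mulrDr mulrDl !(diag_rev_entry ne_ij r_ij fkl kl_ij) ?smr_predD //.
by rewrite mxE (pair_nilD fkl).
Qed.

(** Here x_ji = 0, so the entry (k, l) depends on a triangular block only; being nonisolated makes
    the functions for zero and nonzero diagonal agree. *)
Lemma nonsymmetric_entryD i j k l : i != j -> r i j -> ~~ r j i -> nonisolated r i j ->
  pair_form i j k l -> (k, l) = (i, j) \/ (k, l) = (j, i) ->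
  {in P &, {morph (fun x => Phi x k l) : x y / x + y}} /\ {in P, forall x, Phi x l k = 0}.
Proof.
move=> ne_ij r_ij nr_ji iso fkl kl_ij.
have loc x : x \in P -> Phi x k l = Phi (tri i j (x i i) (x i j) (x j j)) k l /\
                        Phi x l k = Phi (tri i j (x i i) (x i j) (x j j)) l k.
  move=> xP; have [ii ij ji jj] := block_entries ne_ij (x i i) (x i j) 0 (x j j).
  have xji : x j i = 0 by move/smr_predP: xP; apply.
  by case: kl_ij => -[-> ->]; split; apply: diag_local; rewrite ?tri_smr // /tri ?ii ?ij ?ji ?jj.
have nil_uni := nonisolated_nil_unipotent ne_ij r_ij fkl kl_ij iso.
have locE x : x \in P -> Phi x k l = Phi (tri i j 1 (x i j) 1) k l.
  move=> /loc[-> _]; have [/(pair_uniE fkl) //|] := boolP ((x i i != 0) || (x j j != 0)).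
  by rewrite negb_or !negbK => /andP[/eqP-> /eqP->]; apply: (pair_nil_uni fkl).
split=> [x y xP yP|x /loc[_ ->]]; last exact: (pair_zero fkl).
by rewrite /= (locE _ xP) (locE _ yP) (locE _ (smr_predD xP yP)) mxE (pair_uniD fkl).
Qed.

Lemma comparable_entryD i j : i != j -> r i j -> (~~ r j i -> nonisolated r i j) ->
  {in P &, {morph (fun x => Phi x i j) : x y / x + y}} /\
  {in P &, {morph (fun x => Phi x j i) : x y / x + y}}.
Proof.
move=> ne_ij r_ij iso; have ne_ji : j != i by rewrite eq_sym.
have [k [l [fkl kl_ij]]] : exists k l, pair_form i j k l /\ ((k, l) = (i, j) \/ (k, l) = (j, i)).
  by have [_ _ [f|f]] := diag_pair_form ne_ij r_ij; [exists i, j | exists j, i];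
     split=> //; [left|right].
suff [addkl addlk] : {in P &, {morph (fun x => Phi x k l) : x y / x + y}} /\
                     {in P &, {morph (fun x => Phi x l k) : x y / x + y}}.
  by case: kl_ij addkl addlk => -[-> ->].
have [r_ji|nr_ji] := boolP (r j i); last first.
  have [addkl zlk] := nonsymmetric_entryD ne_ij r_ij nr_ji (iso nr_ji) fkl kl_ij.
  by split=> // x y xP yP; rewrite /= !zlk ?smr_predD // addr0.
(* For a symmetric pair, [rev_entryD] is applied to (i, j) and to (j, i); by [symmetric_pair_sides]
   this covers both positions. *)
have [k' [l' [fkl' kl_ji]]] :
    exists k' l', pair_form j i k' l' /\ ((k', l') = (j, i) \/ (k', l') = (i, j)).
  by have [_ _ [f|f]] := diag_pair_form ne_ji r_ji; [exists j, i | exists i, j];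
     split=> //; [left|right].
have [ek el] := symmetric_pair_sides ne_ij r_ij r_ji fkl kl_ij fkl' kl_ji.
split; last exact: (rev_entryD ne_ij r_ij fkl kl_ij).
by have := rev_entryD ne_ji r_ji fkl' kl_ji; rewrite ek el.
Qed.

Lemma diag_additive :
  (forall i j, nonsymmetric_pair r i j -> nonisolated r i j) ->
  (forall i, (forall j, j != i -> ~~ r i j && ~~ r j i) -> {morph diag_fun i : a b / a + b}) ->
  {in P &, {morph Phi : x y / x + y}}.
Proof.
move=> condP condS x y xP yP; have xyP : x + y \in P by apply: smr_predD.
have entryD i j : i != j -> r i j -> Phi (x + y) i j = Phi x i j + Phi y i j /\
                                   Phi (x + y) j i = Phi x j i + Phi y j i.
  move=> ne_ij r_ij; have [|ij ji] := comparable_entryD ne_ij r_ij.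
    by move=> nr; apply: condP.
  by split; [apply: ij | apply: ji].
apply/matrixP => i j; rewrite [RHS]mxE.
have [<-|ne_ij] := eqVneq i j.
  rewrite !diag_entry // mxE.
  have [j' /andP[ne_j' r_j']|iso] := pickP (fun j' => (j' != i) && (r i j' || r j' i)); last first.
    by apply: condS => j' ne_j'; have := iso j'; rewrite ne_j' -negb_or => /negbT.
  case/orP: r_j' => r_j'.
    by rewrite eq_sym in ne_j'; have [+ _ _] := diag_pair_form ne_j' r_j'; apply.
  by have [_ + _] := diag_pair_form ne_j' r_j'; apply.
have ne_ji : j != i by rewrite eq_sym.
have [/(entryD _ _ ne_ij)[] //|nr_ij] := boolP (r i j).
have [/(entryD _ _ ne_ji)[] //|nr_ji] := boolP (r j i).
have z w : w \in P -> Phi w i j = 0.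
  by move=> wP; apply: diag_entry0 => //; move/smr_predP: wP; apply.
by rewrite !z ?addr0.
Qed.

End DiagonalJordanSemiTriple.

(** * The fields with three and four elements *)

Lemma enum_field_isomorphic (D : unitRingType) (s : seq D) :
  GRing.field_axiom D -> commutative (@GRing.mul D) -> uniq s -> (forall x, x \in s) ->
  isomorphic_to_Fq D (size s).
Proof.
move=> D_div mulC s_uniq s_all.
(* All structures are put on the carrier of D itself, so that the isomorphism is the identity. *)
have idK : pcancel (fun x : D => index x s) (nth None [seq Some x | x <- s]).
  by move=> x; rewrite /= (nth_map x) ?index_mem ?nth_index.
pose cntD := PCanIsCountable idK.
have enumP : forall x : D, count_mem x s = 1%N by move=> x; rewrite count_uniq_mem // s_all.
have idomD : GRing.integral_domain_axiom D.
  move=> x y xy0; have [//|x0] := eqVneq x 0.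
  by apply/orP; right; apply/eqP/(mulrI (D_div _ x0)); rewrite xy0 mulr0.
pose comD : comUnitRingType := HB.pack_for comUnitRingType (GRing.UnitRing.sort D)
  (GRing.PzRing_hasCommutativeMul.Build D mulC).
pose fieldD : fieldType := HB.pack_for fieldType (GRing.ComUnitRing.sort comD)
  (GRing.ComUnitRing_isIntegral.Build comD idomD) (GRing.UnitRing_isField.Build comD D_div).
pose F : finFieldType := HB.pack_for finFieldType (GRing.Field.sort fieldD) cntD
  (isFinite.Build D enumP).
exists F; split; first by rewrite cardE enumT unlock.
exists (idfun : {rmorphism D -> F}); by exists id.
Qed.

Lemma isomorphic_to_Fq_comm_exp (D : nzRingType) q :
  isomorphic_to_Fq D q -> commutative (@GRing.mul D) /\ forall x : D, x ^+ q = x.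
Proof.
case=> F [cardF [f f_bij]]; have f_inj := bij_inj f_bij.
split=> [x y|x]; apply: f_inj; first by rewrite !rmorphM mulrC.
by rewrite rmorphXn /= -cardF expf_card.
Qed.

Section SmallFields.

Variables (D : unitRingType) (D_div : GRing.field_axiom D).
Let mul_eq0 := @division_mul_eq0 D D_div.

Variable f : D -> D.
Hypotheses (f_inj : injective f) (f0 : f 0 = 0) (f1 : f 1 = 1).
Hypothesis f_jst : forall a b, f (a * b * a) = f a * f b * f a.

Let f_sqr x : f (x * x) = f x * f x.
Proof. by have := f_jst x 1; rewrite f1 !mulr1. Qed.

Lemma sqr_eq1 (x : D) : x * x = 1 -> x = 1 \/ x = -1.
Proof.
move=> xx; have /mul_eq0[/eqP|/eqP] : (x - 1) * (x + 1) = 0.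
- by rewrite mulrDr mulr1 mulrBl mul1r xx addrA subrK subrr.
- by rewrite subr_eq0 => /eqP; left.
- by rewrite addr_eq0 => /eqP; right.
Qed.

(** Nonzero elements satisfy x^2 = 1, hence are 1 or -1, and injectivity gives f (-1) = -1: f is the
    identity. *)
Lemma cubic_additive : (exists2 a : D, a != 0 & a != 1) ->
  (forall x : D, x ^+ 3 = x) -> {morph f : x y / x + y}.
Proof.
move=> [a a0 a1] cube.
have trich (x : D) : x != 0 -> x = 1 \/ x = -1.
  move=> /D_div xU; apply: sqr_eq1; apply: (mulrI xU).
  by rewrite mulr1 -[RHS]cube exprS expr2.
have m1 : -1 != 1 :> D by have [a1'|<- //] := trich a a0; rewrite a1' eqxx in a1.
have two : 1 + 1 = -1 :> D.
  have [|/eqP|//] := trich (1 + 1); first by rewrite addr_eq0 eq_sym.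
  by rewrite -subr_eq0 addrK oner_eq0.
have fm1 : f (-1) = -1.
  have : f (-1) * f (-1) = 1 by rewrite -f_sqr mulrNN mulr1.
  by case/sqr_eq1 => // /esym; rewrite -{1}f1 => /f_inj/esym/eqP; rewrite (negbTE m1).
have twoN : -1 + -1 = 1 :> D by rewrite -opprD two opprK.
move=> x y; have [->|/trich x1] := eqVneq x 0; first by rewrite f0 !add0r.
have [->|/trich y1] := eqVneq y 0; first by rewrite f0 !addr0.
by case: x1 => ->; case: y1 => ->; rewrite ?(two, twoN, subrr, addNr, f0, f1, fm1).
Qed.

(** Here the characteristic is 2 and x^2 = x + 1 for x outside {0, 1}. As f preserves squares, f (x
    + 1) = f x + 1; and distinct x, y outside {0, 1} satisfy x + y = 1, so that y = x + 1. *)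
Lemma quartic_additive : commutative (@GRing.mul D) ->
  (forall x : D, x ^+ 4 = x) -> {morph f : x y / x + y}.
Proof.
move=> mulC quart.
have char2 (x : D) : x + x = 0.
  have m1 : -1 = 1 :> D by rewrite -(quart (-1)) -signr_odd.
  by rewrite -{2}[x]mul1r -m1 mulN1r subrr.
have sqr (x : D) : x != 0 -> x != 1 -> x * x = x + 1.
  move=> x0 x1; have : (x - 1) * (x * x + (x + 1)) = 0.
    have x3 : x * (x * x) = 1.
      by apply: (mulrI (D_div x0)); rewrite mulr1 -[RHS]quart !exprS expr0 mulr1.
    rewrite mulrBl mul1r !mulrDr mulr1 x3 [X in X - _](_ : _ = x * x + (x + 1)) ?subrr //.
    by rewrite addrC -addrA.
  case/mul_eq0 => [/eqP|/eqP]; first by rewrite subr_eq0 (negbTE x1).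
  rewrite addr_eq0 => /eqP ->; apply/eqP; rewrite eq_sym -subr_eq0 opprK; exact/eqP.
have fsqr (x : D) : x != 0 -> x != 1 -> f (x + 1) = f x + 1.
  move=> x0 x1; rewrite -sqr // f_sqr sqr //.
    by apply: contra_neq x0; rewrite -{1}f0; apply: f_inj.
  by apply: contra_neq x1; rewrite -{1}f1; apply: f_inj.
move=> x y; have [->|x0] := eqVneq x 0; first by rewrite f0 !add0r.
have [->|y0] := eqVneq y 0; first by rewrite f0 !addr0.
have [<-|ne_xy] := eqVneq x y; first by rewrite !char2 f0.
have [x1|x1] := eqVneq x 1.
  by rewrite x1 addrC f1 [RHS]addrC fsqr // -x1 eq_sym.
have [->|y1] := eqVneq y 1; first by rewrite f1 fsqr.
have xy1 : x + y = 1.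
  have xy0 : x + y != 0.
    by apply: contra_neq ne_xy => xy0; rewrite -[LHS]addr0 -(char2 y) addrA xy0 add0r.
  apply: (mulrI (D_div xy0)); rewrite mulr1 mulrDl !mulrDr (mulC y x) !sqr //.
  by rewrite -addrA (addrA (x * y)) char2 add0r addrACA char2 addr0.
have -> : y = x + 1 by rewrite -xy1 addrA char2 add0r.
by rewrite fsqr // !addrA !char2 !add0r f1.
Qed.

End SmallFields.

Lemma center_card_neq01 (D : nzRingType) :
  center_card_gt D 2 -> exists z : D, [/\ z != 0, z != 1 & central z].
Proof.
case=> s [s_uniq s_gt2 s_central].
have [z zs zn01] : exists2 z, z \in s & z \notin [:: 0; 1].
  apply/hasP; apply: contraTT s_gt2 => /hasPn sub; rewrite -leqNgt.
  by apply: (uniq_leq_size (s2 := [:: 0; 1]) s_uniq) => x /sub; rewrite negbK.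
by move: zn01; rewrite !inE negb_or => /andP[z0 z1]; exists z; split=> //; apply: s_central.
Qed.

(** Expanding (x + 1)^-1 (x + 1) = 1 gives x^2 + x + 1 = 0 for x other than 0 and -1. If 2 is
    nonzero, x = 1 shows 3 = 0, so (x - 1)^2 = 0 and D = {0, 1, -1}. In characteristic 2 the central
    z yields D = {0, 1, z, z + 1}. *)
Lemma inv_additive_small (D : unitRingType) : GRing.field_axiom D -> center_card_gt D 2 ->
  (forall a b : D, (a + b)^-1 = a^-1 + b^-1) ->
  isomorphic_to_Fq D 3 \/ isomorphic_to_Fq D 4.
Proof.
move=> D_div /center_card_neq01[z [z0 z1 zC]] invD.
have mul_eq0 := @division_mul_eq0 D D_div.
have quad (x : D) : x != 0 -> x != -1 -> x * x + (x + 1) = 0.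
  move=> x0 x1; have xU := D_div _ x0; have x1U : x + 1 \is a GRing.unit.
    by apply: D_div; rewrite addr_eq0.
  have := mulVr x1U; rewrite invD invr1 mulrDl !mulrDr mulVr // !mulr1 mul1r addrA.
  rewrite -[X in _ = X]add0r => /addIr/(congr1 (fun y => y * x)).
  by rewrite mul0r !mulrDl mulVr // mul1r addrC.
have n1 := oner_neq0 D.
have [char2|two0] := eqVneq (1 + 1 : D) 0; last first.
  left; have m1 : 1 != -1 :> D by rewrite -addr_eq0.
  have two : 1 + 1 = -1 :> D.
    by apply/eqP; rewrite -addr_eq0 -addrA; move/eqP: (quad 1 n1 m1); rewrite mulr1.
  have all3 (x : D) : x \in [:: 0; 1; -1].
    rewrite !inE; have [//|x0] := eqVneq x 0; have [|xm1] := eqVneq x (-1); first by rewrite orbT.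
    suff xx : (x - 1) * (x - 1) = 0 by case: (mul_eq0 _ _ xx) => /eqP; rewrite subr_eq0 => ->.
    rewrite mulrBr mulr1 mulrBl mul1r opprB -[RHS](quad x x0 xm1) -addrA; congr (_ + _).
    by rewrite addrCA addrC; congr (_ + _);
       rewrite -opprD -{1}[x]mulr1 -{2}[x]mulr1 -mulrDr two mulrN1 opprK.
  have uniq3 : uniq [:: 0; 1; -1 : D].
    by rewrite /= !inE !negb_or eq_sym n1 [0 == _]eq_sym oppr_eq0 n1 m1.
  apply: (enum_field_isomorphic D_div _ uniq3 all3) => x y.
  have:= all3 x; rewrite !inE => /or3P[]/eqP->;
  by rewrite ?(mul0r, mulr0, mul1r, mulr1, mulN1r, mulrN1).
right; have add2 (x : D) : x + x = 0 by rewrite -{1}[x]mulr1 -{2}[x]mulr1 -mulrDr char2 mulr0.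
have eqD (x y : D) : (x + y == 0) = (x == y).
  by rewrite addr_eq0; congr (_ == _); apply/eqP; rewrite eq_sym -addr_eq0 add2.
have sqr (x : D) : x != 0 -> x != 1 -> x * x = x + 1.
  move=> x0 x1; apply/eqP; rewrite -eqD quad // -addr_eq0; apply: contra_neq x1 => /eqP.
  by rewrite eqD => /eqP.
have all4 (x : D) : x \in [:: 0; 1; z; z + 1].
  rewrite !inE; have [//|x0] := eqVneq x 0; have [//|x1] := eqVneq x 1.
  have [//|ne_xz] := eqVneq x z; rewrite /=.
  (* If x + z differs from 0 and 1, its square is x + z + 1 by [sqr]; but z is central, so the
     square is also x^2 + z^2 = x + z. *)
  have [xz1|xz1] := eqVneq (x + z) 1; first by rewrite -xz1 addrCA add2 addr0.
  case/eqP: n1; have xz0 : x + z != 0 by rewrite eqD.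
  have := sqr _ xz0 xz1; rewrite mulrDl !mulrDr (zC x) !sqr //.
  rewrite -addrA (addrA (x * z)) add2 add0r addrACA char2 addr0.
  by rewrite -[LHS]addr0 => /addrI.
have uniq4 : uniq [:: 0; 1; z; z + 1].
  rewrite /= !inE !negb_or ![0 == _]eq_sym n1 z0 eqD z1 ![1 == _]eq_sym z1 /=.
  rewrite -[z + 1 == 1]subr_eq0 addrK z0 /= andbT eq_sym -subr_eq0 addrAC subrr add0r //.
apply: (enum_field_isomorphic D_div _ uniq4 all4) => x y.
have:= all4 x; rewrite !inE => /or4P[]/eqP->;
  rewrite ?(mul0r, mulr0, mul1r, mulr1) //; first exact: zC.
by rewrite mulrDl mulrDr mul1r mulr1 (zC y).
Qed.

(** * Necessity: maps that detect an isolated pair or a singleton component *)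

Section Necessity.

Variables (D : unitRingType) (D_div : GRing.field_axiom D) (D_center : center_card_gt D 2).
Variables (n : nat) (r : rel 'I_n) (r_refl : reflexive r) (r_trans : transitive r).
Let mul_eq0 := @division_mul_eq0 D D_div.

Local Notation P := (@smr_pred D n r).
Local Notation S := (smr D r_refl r_trans).
Let in_smr (A : 'M[D]_n) (AP : A \in P) : S := Smr r_refl r_trans AP.

Lemma smr_val_entry (x : S) a b : ~~ r a b -> smr_val x a b = 0.
Proof. by have /smr_predP := smr_valP x; apply. Qed.

Lemma smr_valM (x y : S) : smr_val (x * y) = smr_val x * smr_val y.
Proof. by []. Qed.

Lemma smr_valD (x y : S) : smr_val (x + y) = smr_val x + smr_val y.
Proof. by []. Qed.

Lemma nonsymmetric_pair_nonisolated :
  (forall phi : S -> 'M[D]_n, injective phi -> jordan_semi_triple phi -> additive_map phi) ->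
  forall i j, nonsymmetric_pair r i j -> nonisolated r i j.
Proof.
move=> all_add i j [r_ij nr_ji].
have ne_ij : i != j by apply: contraNneq nr_ji => ->; apply: r_refl.
have [/existsP[k /and3P[ki kj /or3P kr]]|iso] := boolP [exists k, [&& k != i, k != j &
    [|| r k i && r i j, r i k && r k j | r i j && r j k]]].
  exists k; split=> //; case: kr => /andP[]; by [constructor 1|constructor 2|constructor 3].
have isoP k : k != i -> k != j -> [/\ ~~ r k i, ~~ (r i k && r k j) & ~~ r j k].
  move=> ki kj; move/existsPn/(_ k): iso; rewrite ki kj /= r_ij andbT !negb_or /=.
  by case/and3P.
have [lam [lam0 lam1 lamC]] := center_card_neq01 D_center.
(* Isolation makes x -> [[x_ii, x_ij], [0, x_jj]] multiplicative: column i and row j vanish off the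
   diagonal, and no third index contributes to the entry (i, j). *)
have col0 (x : S) k : k != i -> x k i = 0.
  move=> ki; apply: smr_val_entry; have [->//|kj] := eqVneq k j; by have [] := isoP k ki kj.
have row0 (x : S) k : k != j -> x j k = 0.
  move=> kj; apply: smr_val_entry; have [->//|ki] := eqVneq k i; by have [] := isoP k ki kj.
have Mii (x y : S) : (x * y : S) i i = x i i * y i i.
  rewrite smr_valM mxE (bigD1 i) //= big1 ?addr0 // => k ki; by rewrite (col0 y) ?mulr0.
have Mjj (x y : S) : (x * y : S) j j = x j j * y j j.
  rewrite smr_valM mxE (bigD1 j) //= big1 ?addr0 // => k kj; by rewrite (row0 x) ?mul0r.
have Mij (x y : S) : (x * y : S) i j = x i i * y i j + x i j * y j j.
  rewrite smr_valM mxE (bigD1 i) //= (bigD1 j) ?(eq_sym j) //= big1 ?addr0 // => k /andP[ki kj].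
  have [_ + _] := isoP k ki kj; rewrite negb_and => /orP[] nr.
    by rewrite (smr_val_entry x nr) mul0r.
  by rewrite (smr_val_entry y nr) mulr0.
(* [wt] is the correction turning b into lam b exactly when a = c = 0. *)
pose wt (a b c : D) := if (a == 0) && (c == 0) then (lam - 1) * b else 0.
have mul_neq0 (a b : D) : a != 0 -> b != 0 -> a * b != 0.
  by move=> a0 b0; apply/eqP => /mul_eq0[]/eqP; apply/negP.
(* Both sides vanish unless a, c are nonzero and a' = c' = 0, where both equal (lam - 1) a b' c
   because lam is central. *)
have wtM a b c a' b' c' :
    wt (a * a' * a) (a * a' * b + (a * b' + b * c') * c) (c * c' * c) =
    a * a' * wt a b c + (a * wt a' b' c' + wt a b c * c') * c.
  have comm_lam u v : u * ((lam - 1) * v) = (lam - 1) * (u * v).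
    by rewrite !mulrA; congr (_ * v); rewrite mulrBr mulrBl mulr1 mul1r (lamC u).
  rewrite /wt; have [->|a0] := eqVneq a 0; have [->|c0] := eqVneq c 0;
    rewrite ?eqxx /= ?(mulr0, mul0r, addr0, add0r, eqxx) //=.
  - have [->|c'0] := eqVneq c' 0; first by rewrite !mulr0 !mul0r mulr0 if_same.
    by rewrite (negbTE (mul_neq0 _ _ (mul_neq0 _ _ c0 c'0) c0)).
  - have [->|a'0] := eqVneq a' 0; first by rewrite !(mulr0, mul0r) if_same.
    by rewrite (negbTE (mul_neq0 _ _ (mul_neq0 _ _ a0 a'0) a0)).
  have [->|a'0] := eqVneq a' 0; last first.
    by rewrite (negbTE (mul_neq0 _ _ (mul_neq0 _ _ a0 a'0) a0)) /= mulr0 mul0r.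
  have [->|c'0] := eqVneq c' 0; last first.
    by rewrite (negbTE (mul_neq0 _ _ (mul_neq0 _ _ c0 c'0) c0)) andbF /= mulr0 mul0r.
  by rewrite !(mulr0, mul0r, addr0, add0r, eqxx) /= comm_lam !mulrA.
pose w (x : S) := wt (x i i) (x i j) (x j j).
pose phi (x : S) := smr_val x + w x *: delta_mx i j.
have mulP (x y : S) u v : (smr_val x + u *: delta_mx i j) * (smr_val y + v *: delta_mx i j) =
    smr_val (x * y) + (x i i * v + u * y j j) *: delta_mx i j.
  rewrite mulrDl !mulrDr smr_valM mul_delta (eq_sym j) (negbTE ne_ij) addr0 -addrA scalerDl.
  by rewrite mulmx_delta_row ?delta_mulmx_col // => k; [apply: row0 | apply: col0].
have phi_jst : jordan_semi_triple phi.
  move=> x y; rewrite /phi !mulP; congr (_ + _ *: _).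
  by rewrite /w !Mii !Mjj !Mij !Mii wtM.
have phi_inj : injective phi.
  move=> x y /matrixP eq_xy; apply: val_inj.
  have entry a b : ~~ ((a == i) && (b == j)) -> x a b = y a b.
    by move=> ab; have := eq_xy a b; rewrite !mxE (negbTE ab) !mulr0 !addr0.
  have ii : x i i = y i i by apply: entry; rewrite eqxx.
  have jj : x j j = y j j by apply: entry; rewrite eqxx andbT eq_sym.
  apply/matrixP => a b; have [/andP[/eqP-> /eqP->]|/entry//] := boolP ((a == i) && (b == j)).
  have := eq_xy i j; rewrite !mxE !eqxx !mulr1 /w /wt ii jj; case: ifP => _; last by rewrite !addr0.
  have lamE c : c + (lam - 1) * c = lam * c by rewrite mulrBl mul1r addrC subrK.
  by rewrite !lamE => /(mulrI (D_div lam0)).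
have iP : delta_mx i i \in P by apply: smr_pred_delta.
have ijP : delta_mx i j \in P by apply: smr_pred_delta.
have ne_ji : j != i by rewrite eq_sym.
have phiE (x : S) : phi x i j = x i j + wt (x i i) (x i j) (x j j).
  by rewrite !mxE !eqxx mulr1.
(* E_ii + E_ij has a nonzero diagonal entry, so its entry (i, j) stays 1, while that of E_ij becomes
   lam; additivity would give lam = 1. *)
have /matrixP/(_ i j) := all_add phi phi_inj phi_jst (in_smr iP) (in_smr ijP).
rewrite [RHS]mxE !phiE smr_valD /= !mxE !eqxx (negbTE ne_ij) (negbTE ne_ji) /= !(addr0, add0r).
rewrite /wt !eqxx oner_eq0 /= !(addr0, add0r) mulr1 addrC subrK => /esym/eqP.
by rewrite (negbTE lam1).
Qed.

(** At a singleton component the entry (i, i) splits off as a direct factor D. Inverting it, with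
    0^-1 = 0, is an injective Jordan semi-triple map, so inversion on D must be additive. *)
Lemma singleton_component_small :
  (forall phi : S -> 'M[D]_n, injective phi -> jordan_semi_triple phi -> additive_map phi) ->
  has_singleton_component r -> isomorphic_to_Fq D 3 \/ isomorphic_to_Fq D 4.
Proof.
move=> all_add [i /eqP/cards1P[i' comp_i]]; apply: inv_additive_small => // a b.
have compP k : k != i -> ~~ (r i k || r k i).
  move=> ki; have: i \in component r i by rewrite inE.
  rewrite comp_i inE => /eqP ei; apply: contra ki => ik.
  suff: k \in component r i by rewrite comp_i inE ei.
  have [-> | ne_ik] := eqVneq i k; first by rewrite inE.
  by rewrite inE; apply: connect1; rewrite /comparability_graph ne_ik.
have col0 (x : S) k : k != i -> x k i = 0.
  by move=> /compP; rewrite negb_or => /andP[_]; apply: smr_val_entry.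
have row0 (x : S) k : k != i -> x i k = 0.
  by move=> /compP; rewrite negb_or => /andP[+ _]; apply: smr_val_entry.
have Mii (x y : S) : (x * y : S) i i = x i i * y i i.
  by rewrite smr_valM mxE (bigD1 i) //= big1 ?addr0 // => k ki; rewrite (col0 y) ?mulr0.
pose phi (x : S) := smr_val x + ((x i i)^-1 - x i i) *: delta_mx i i.
have mulP (x y : S) u v : (smr_val x + (u - x i i) *: delta_mx i i) *
    (smr_val y + (v - y i i) *: delta_mx i i) =
    smr_val (x * y) + (u * v - (x * y : S) i i) *: delta_mx i i.
  rewrite mulrDl !mulrDr -smr_valM mul_delta eqxx -addrA; congr (_ + _).
  rewrite mulmx_delta_row ?delta_mulmx_col => [|k|k]; [|exact: row0|exact: col0].
  rewrite -!scalerDl; congr (_ *: _).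
  by rewrite Mii -mulrDr (addrC (y i i)) subrK mulrBr mulrBl addrC addrA subrK.
have invM (x y : D) : (x * y * x)^-1 = x^-1 * y^-1 * x^-1.
  have [->|x0] := eqVneq x 0; first by rewrite !mul0r invr0 !mul0r.
  have [->|y0] := eqVneq y 0; first by rewrite !(mulr0, mul0r) invr0 mulr0 mul0r.
  have [xU yU] := (D_div x0, D_div y0).
  by rewrite !invrM ?unitrMl // mulrA.
have phi_jst : jordan_semi_triple phi.
  by move=> x y; rewrite /phi !mulP !Mii invM.
have phiE (x : S) : phi x i i = (x i i)^-1.
  by rewrite !mxE !eqxx mulr1 addrC subrK.
have phi_inj : injective phi.
  move=> x y eq_xy; apply: val_inj; apply/matrixP => k l.
  have [/andP[/eqP-> /eqP->]|kl] := boolP ((k == i) && (l == i)).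
    by apply: invr_inj; rewrite -!phiE eq_xy.
  by have /matrixP/(_ k l) := eq_xy; rewrite !mxE (negbTE kl) !mulr0 !addr0.
have aP c : c *: delta_mx i i \in P by apply: smr_predZ_delta.
have /matrixP/(_ i i) := all_add phi phi_inj phi_jst (in_smr (aP a)) (in_smr (aP b)).
by rewrite [RHS]mxE !phiE smr_valD /= !mxE !eqxx !mulr1.
Qed.

End Necessity.

(** * Sufficiency: normalization at 1 and conclusion *)

Section UnitalNormalization.

Variables (R S : pzRingType) (phi : R -> S).
Hypothesis phi_jst : jordan_semi_triple phi.
Let u := phi 1.

Lemma jst_image1_sqr x : u * u * phi x = phi x.
Proof.
have u3 : u * u * u = u by rewrite -phi_jst !mulr1.
have phiE : phi x = u * phi x * u by rewrite -phi_jst mul1r mulr1.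
by rewrite phiE !mulrA u3.
Qed.

Lemma jst_image1_comm x : phi x * u = u * phi x.
Proof.
have phiE : u * phi x * u = phi x by rewrite -phi_jst mul1r mulr1.
by rewrite -[in RHS]phiE !mulrA jst_image1_sqr.
Qed.

(** u commutes with the image and its square acts there as the identity, so two of the three factors
    u cancel. *)
Lemma jst_image1_mul : jordan_semi_triple (fun x => u * phi x).
Proof.
move=> x y; rewrite /= phi_jst.
rewrite -!mulrA (mulrA (phi y) u) jst_image1_comm -/u -!mulrA (mulrA u u) (mulrA (u * u)).
by rewrite jst_image1_sqr.
Qed.

End UnitalNormalization.

Lemma smr_jst_additive (D : unitRingType) (D_div : GRing.field_axiom D)
    (D_center : center_card_gt D 2) (n : nat) (n_ge1 : (1 <= n)%N)
    (r : rel 'I_n) (r_refl : reflexive r) (r_trans : transitive r) :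
  (forall i j : 'I_n, nonsymmetric_pair r i j -> nonisolated r i j) ->
  (has_singleton_component r -> isomorphic_to_Fq D 3 \/ isomorphic_to_Fq D 4) ->
  forall phi : smr D r_refl r_trans -> 'M[D]_n,
    injective phi -> jordan_semi_triple phi -> additive_map phi.
Proof.
move=> condP condS phi phi_inj phi_jst; pose u := phi 1.
have u_sqr := jst_image1_sqr phi_jst; rewrite -/u in u_sqr.
have D_gt2 : exists2 a : D, a != 0 & a != 1.
  by have [a [a0 a1 _]] := center_card_neq01 D_center; exists a.
(* [sm] takes the default value 0 outside [P], which lets [Phi] be defined on all matrices. *)
pose P := @smr_pred D n r; pose sm (A : 'M[D]_n) : smr D r_refl r_trans := insubd 0 A.
have smK A : A \in P -> smr_val (sm A) = A by move=> AP; exact: (insubdK _ AP).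
have smM A B : A \in P -> B \in P -> sm (A * B) = sm A * sm B.
  by move=> AP BP; apply: val_inj; rewrite /= !smK ?(smr_predM r_refl r_trans).
have sm_val x : sm (smr_val x) = x := valKd 0 x.
pose Phi A := u * phi (sm A).
have uPhi A : u * Phi A = phi (sm A) by rewrite mulrA u_sqr.
have Phi_inj : {in P &, injective Phi}.
  move=> A B AP BP /(congr1 (fun X => u * X)); rewrite !uPhi => /phi_inj eq_sm.
  by rewrite -(smK A) // eq_sm smK.
have Phi_jst : {in P &, forall A B, Phi (A * B * A) = Phi A * Phi B * Phi A}.
  move=> A B AP BP; rewrite /Phi !smM ?(smr_predM r_refl r_trans) //.
  exact: (jst_image1_mul phi_jst).
have sm1 : sm 1 = 1 by apply: val_inj; rewrite /= smK // (smr_pred1 D r_refl r_trans).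
have Phi_unit : {in P, forall A, Phi 1 * Phi A = Phi A /\ Phi A * Phi 1 = Phi A}.
  move=> A AP; rewrite /Phi sm1 -/u; split; first by rewrite -mulrA uPhi.
  rewrite mulrA -(mulrA u) (jst_image1_comm phi_jst) -!mulrA (jst_image1_comm phi_jst).
  by rewrite -/u !mulrA u_sqr.
have Phi_0 := jst0 D_div r_refl r_trans Phi_inj Phi_jst Phi_unit.
have Phi_1 := jst1 D_div r_refl r_trans Phi_inj Phi_jst Phi_unit.
have [g [h [gh hg gd]]] := orthogonal_idempotents_conj D_div
  (jst_delta_neq0 D_div r_refl r_trans Phi_inj Phi_jst Phi_unit)
  (jst_delta_orth D_div n_ge1 r_refl r_trans D_gt2 Phi_inj Phi_jst Phi_unit).
pose Psi A := g * Phi A * h.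
have Psi_inj : {in P &, injective Psi}.
  move=> A B AP BP /(congr1 (fun X => h * X * g)).
  by rewrite !mulrA hg !mul1r -!mulrA hg !mulr1; apply: Phi_inj.
have Psi_jst : {in P &, forall A B, Psi (A * B * A) = Psi A * Psi B * Psi A}.
  move=> A B AP BP; rewrite /Psi Phi_jst // -!mulrA (mulrA h g) hg mul1r.
  by rewrite (mulrA h g) hg mul1r.
have Psi_0 : Psi 0 = 0 by rewrite /Psi Phi_0 mulr0 mul0r.
have Psi_1 : Psi 1 = 1 by rewrite /Psi Phi_1 mulr1.
have Psi_delta k : Psi (delta_mx k k) = delta_mx k k by rewrite /Psi gd -mulrA gh mulr1.
have Psi_add : {in P &, {morph Psi : A B / A + B}}.
  apply: (diag_additive D_div r_refl r_trans Psi_inj Psi_jst Psi_0 Psi_1 Psi_delta condP) => i iso.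
  have s_inj := diag_fun_inj r_refl r_trans Psi_inj Psi_jst Psi_0 Psi_1 Psi_delta (i := i).
  have s_jst := diag_funM r_refl r_trans Psi_jst Psi_0 Psi_1 Psi_delta i.
  have s0 := diag_fun0 Psi_0 i; have s1 := diag_fun1 Psi_delta i.
  (* An index without neighbours is a singleton component; the two fields enter only through
     commutativity and x^3 = x or x^4 = x. *)
  have [] := condS; last 2 first.
  - by move=> /isomorphic_to_Fq_comm_exp[_ cube]; apply: cubic_additive.
  - by move=> /isomorphic_to_Fq_comm_exp[mulC quart]; apply: quartic_additive.
  exists i; apply/eqP/cards1P; exists i; apply/setP => k; rewrite !inE.
  apply/idP/eqP => [/connectP[[|m p] //= /andP[/andP[ne_im r_im] _] _]|->]; last exact: connect0.
  by have := iso m; rewrite eq_sym ne_im -negb_or r_im => /(_ isT).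
(* Both normalizations are undone by fixed left and right factors, which preserve additivity. *)
have PhiE A : Phi A = h * Psi A * g by rewrite /Psi !mulrA hg mul1r -mulrA hg mulr1.
have phiE x : phi x = u * (h * Psi (smr_val x) * g) by rewrite -PhiE uPhi sm_val.
move=> x y; rewrite !phiE smr_valD Psi_add ?smr_valP //.
by rewrite !(mulrDr, mulrDl).
Qed.

Theorem theorem3p9 (D : unitRingType) (D_div : GRing.field_axiom D)
    (D_center : center_card_gt D 2) (n : nat) (n_ge1 : (1 <= n)%N)
    (r : rel 'I_n) (r_refl : reflexive r) (r_trans : transitive r) :
  (forall phi : smr D r_refl r_trans -> 'M[D]_n,
      injective phi -> jordan_semi_triple phi -> additive_map phi)
  <->
  ((forall i j : 'I_n, nonsymmetric_pair r i j -> nonisolated r i j) /\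
   (has_singleton_component r ->
      isomorphic_to_Fq D 3 \/ isomorphic_to_Fq D 4)).
Proof.
split=> [all_add|[condP condS]]; last exact: smr_jst_additive.
split; first exact: (nonsymmetric_pair_nonisolated D_div D_center all_add).
exact: (singleton_component_small D_div D_center all_add).
Qed.
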